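(* Let $A$ be a countable noetherian commutative ring. Let $M$ be an $A$-module. Then the set of submodules of $M$ is countable if and only if $M$ is minimax and satisfies Properties $(\mathsf{L}_2)$ and $(\mathsf{L}_{1+1})$. Otherwise, $M$ has at least $2^{\aleph_0}$ submodules, with equality if $M$ is countable.
   Context: Rings are associative, unital and commutative; countable sets are not assumed to be infinite. A subquotient of $M$ is a quotient of a submodule of $M$. An $A$-module is minimax if it has an artinian quotient with noetherian kernel. An $A$-module $M$ satisfies Property $(\mathsf{L}_2)$ if for every artinian quotient $Q$ of $M$, the poset of submodules of $Q$ (ordered by inclusion) does not contain any chain isomorphic to the ordinal $\omega^2$. An $A$-module $M$ satisfies Property $(\mathsf{L}_{1+1})$ if no subquotient of $M$ is isomorphic to the square $P\oplus P$ of some artinian $A$-module $P$ of infinite length. *)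

(* Defs.v *)
From HB Require Import structures.
From mathcomp Require Import all_boot all_order all_algebra.
From mathcomp Require Import boolp classical_sets functions cardinality.

Set Implicit Arguments.
Unset Strict Implicit.
Unset Printing Implicit Defensive.

Import Order.TTheory GRing.Theory.
Local Open Scope classical_set_scope.
Local Open Scope card_scope.
Local Open Scope ring_scope.

(* [comPzRingType] (as opposed to [comNzRingType]) does not exclude the zero
   ring. *)

Section Submodules.
Variables (A : comPzRingType) (M : lmodType A).

(* By proof irrelevance, two submodules are equal if and only if their
   underlying sets are, so that [submodule M] is in bijection with the set of
   submodules of [M]. *)
Record submodule := Submodule {
  submodule_set :> set M;
  submodule_closed : submod_closed (mem submodule_set) }.

Definition submodule_pred (N : submodule) : {pred M} := mem (submodule_set N).

HB.instance Definition _ (N : submodule) :=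
  GRing.isSubmodClosed.Build A M (submodule_pred N) (submodule_closed N).

(* A submodule regarded as a module in its own right. *)
Definition submodule_sort (N : submodule) := {x : M | x \in submodule_pred N}.

HB.instance Definition _ (N : submodule) := SubChoice.on (submodule_sort N).
HB.instance Definition _ (N : submodule) :=
  [SubChoice_isSubLmodule of submodule_sort N by <:].

End Submodules.

Section Modules.
Variable A : comPzRingType.
Implicit Types M P Q : lmodType A.

Definition module_noetherian M :=
  forall N : nat -> submodule M, (forall i, N i `<=` N i.+1) ->
  exists n, forall m, (n <= m)%N -> N m = N n.

Definition module_artinian M :=
  forall N : nat -> submodule M, (forall i, N i.+1 `<=` N i) ->
  exists n, forall m, (n <= m)%N -> N m = N n.

Definition module_finite_length M :=
  exists l : nat, forall (n : nat) (N : nat -> submodule M),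
    (forall i, (i < n)%N -> N i `<` N i.+1) -> (n <= l)%N.

(* [Q], together with the projection [p], is up to isomorphism a quotient of [M]
   (by the kernel of [p]). *)
Definition quotient_map M Q (p : {linear M -> Q}) :=
  forall y : Q, exists x : M, p x = y.

Definition module_minimax M :=
  exists (Q : lmodType A) (p : {linear M -> Q}) (K : submodule M),
    [/\ quotient_map p,
        submodule_set K = [set x | p x = 0],
        module_artinian Q &
        module_noetherian (submodule_sort K)].

(* The ordinal omega^2 is [nat * nat] with the lexicographic order; the chain
   is the image of [c]. *)
Definition has_omega2_chain M :=
  exists c : nat *l nat -> submodule M,
    forall a b : nat *l nat, (a <= b)%O <-> c a `<=` c b.

Definition property_L2 M :=
  forall (Q : lmodType A) (p : {linear M -> Q}),
    quotient_map p -> module_artinian Q -> ~ has_omega2_chain Q.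

Definition iso_to_subquotient P M :=
  exists (N : submodule M) (p : {linear submodule_sort N -> P}),
    quotient_map p.

Definition property_L11 M :=
  forall P : lmodType A,
    module_artinian P -> ~ module_finite_length P ->
    ~ iso_to_subquotient (P * P)%type M.

End Modules.

(* The submodules of the regular module [A^o] are the ideals of [A]. *)
Definition ring_noetherian (A : comPzRingType) := module_noetherian A^o.

(* Main.v *)
(* Call an interval of submodules small if it is finitely generated; modulo small
   intervals, submodules of an artinian module behave like a lattice of finite
   length as soon as there is no chain of type omega^2.

   Few submodules.  Let Q be the artinian quotient.  Every submodule H of Q is
   finitely generated over its smallest submodule D with H / D finitely
   generated, so it suffices to count these connected D.  Climbing through
   minimal non-small steps P / X, which is a well-founded process by (L_2), it
   suffices that X have countably many such P; by (L_{1+1}) distinct ones are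
   independent over X, so that infinitely many would give a forbidden chain.
   Submodules of M are then counted by their trace on the noetherian kernel K
   and their image in Q: two submodules H, H0 with the same data satisfy
   H / (H /\ H0) noetherian, and H /\ H0 contains a submodule depending on H0
   only.

   Many submodules.  If M is not minimax, either every quotient of M by a finitely
   generated submodule has an element whose annihilator lies in a nonmaximal
   prime, or some such quotient is locally of finite length but not artinian;
   both give a binary tree of submodules.  In the other two cases, devissage
   produces X, minimal among the submodules that are not small (resp. have a
   chain of type omega^2), and a maximal ideal m all of whose elements are locally
   nilpotent on X.  If X has infinite length, some a in m is surjective on X, and
   the graphs of the operators sum_{n in S} a^n, for S a set of natural numbers,
   are distinct submodules of X (+) X.  If X has a chain of type omega^2, prime
   avoidance gives a, b in m such that X[a, b] has finite length, and the kernels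
   of the operators a - sum_{n in S} b^(n+1) are distinct. *)
Require Import Defs.
From HB Require Import structures.
From mathcomp Require Import all_boot all_order all_algebra.
From mathcomp Require Import boolp classical_sets functions cardinality.
From mathcomp Require Import ring.

Set Implicit Arguments.
Unset Strict Implicit.
Unset Printing Implicit Defensive.

Import GRing.Theory.
Local Open Scope ring_scope.

(** * Linear identities in modules *)

Section LinearExpressions.
Variables (A : pzRingType) (M : lmodType A).

Inductive lexpr :=
  | LVar of nat | LZero | LAdd of lexpr & lexpr | LOpp of lexpr
  | LScale of A & lexpr.

Fixpoint leval (env : seq M) e : M :=
  match e with
  | LVar n => nth 0 env n
  | LZero => 0
  | LAdd e1 e2 => leval env e1 + leval env e2
  | LOpp e1 => - leval env e1
  | LScale a e1 => a *: leval env e1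
  end.

Fixpoint lcoef e i : A :=
  match e with
  | LVar n => (n == i)%:R
  | LZero => 0
  | LAdd e1 e2 => lcoef e1 i + lcoef e2 i
  | LOpp e1 => - lcoef e1 i
  | LScale a e1 => a * lcoef e1 i
  end.

Lemma leval_sum (env : seq M) e :
  leval env e = \sum_(i < size env) lcoef e i *: nth 0 env i.
Proof.
elim: e => [n||e1 IH1 e2 IH2|e1 IH1|a e1 IH1] /=.
- have [lt_n|ge_n] := ltnP n (size env).
    rewrite (bigD1 (Ordinal lt_n)) //= eqxx scale1r big1 ?addr0 // => i ne_i.
    rewrite (_ : n == i = false) ?scale0r //; apply: negbTE.
    by apply: contra ne_i => /eqP def_n; apply/eqP/val_inj; rewrite /= def_n.
  rewrite nth_default // big1 // => i _.
  by rewrite (_ : n == i = false) ?scale0r // gtn_eqF // (leq_trans _ ge_n).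
- by rewrite big1 // => i _; rewrite scale0r.
- by rewrite IH1 IH2 -big_split; apply: eq_bigr => i _; rewrite scalerDl.
- by rewrite IH1 -sumrN; apply: eq_bigr => i _; rewrite scaleNr.
- by rewrite IH1 scaler_sumr; apply: eq_bigr => i _; rewrite scalerA.
Qed.

(** Written as a recursive conjunction so that [/=] unfolds it, for a concrete list of atoms, into
    one coefficient identity per atom. *)
Fixpoint all_below (P : nat -> Prop) n : Prop :=
  if n is n'.+1 then all_below P n' /\ P n' else True.

Lemma leval_eq (env : seq M) e1 e2 :
  all_below (fun i => lcoef e1 i = lcoef e2 i) (size env) ->
  leval env e1 = leval env e2.
Proof.
move=> eq12; rewrite !leval_sum; apply: eq_bigr => i _; congr (_ *: _).
have: (i < size env)%N by [].
elim: (size env) (nat_of_ord i) eq12 => // n IH j /= [IHn eqn].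
by rewrite ltnS leq_eqVlt => /predU1P[->|/IH->].
Qed.

End LinearExpressions.

Ltac lmod_mem x l :=
  lazymatch l with
  | nil => constr:(false)
  | cons x _ => constr:(true)
  | cons _ ?l' => lmod_mem x l'
  end.
Ltac lmod_add x l :=
  lazymatch lmod_mem x l with true => l | false => constr:(cons x l) end.
Ltac lmod_index x l :=
  lazymatch l with
  | cons x _ => constr:(O)
  | cons _ ?l' => let n := lmod_index x l' in constr:(S n)
  end.
Ltac lmod_atoms t l :=
  lazymatch t with
  | GRing.add ?x ?y => let l1 := lmod_atoms x l in lmod_atoms y l1
  | GRing.opp ?x => lmod_atoms x l
  | GRing.scale _ ?x => lmod_atoms x l
  | GRing.zero => l
  | ?x => lmod_add x l
  end.
Ltac lmod_reify A t l :=
  lazymatch t with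
  | GRing.add ?x ?y =>
      let e1 := lmod_reify A x l in let e2 := lmod_reify A y l in
      constr:(@LAdd A e1 e2)
  | GRing.opp ?x => let e := lmod_reify A x l in constr:(@LOpp A e)
  | GRing.scale ?a ?x => let e := lmod_reify A x l in constr:(@LScale A a e)
  | GRing.zero => constr:(@LZero A)
  | ?x => let n := lmod_index x l in constr:(@LVar A n)
  end.
(* Decides linear identities in a module: the coefficients of each atom on both
   sides are compared in the scalar ring. *)
Ltac module_ring :=
  lazymatch goal with
  | |- @eq ?T ?x ?y =>
    (* Unification recovers the scalar ring and the module structure from the carrier type of the
       equation. *)
    let e := open_constr:(@Logic.eq_refl Type T : T = @GRing.Lmodule.sort _ _) in
    lazymatch type of e with
    | _ = @GRing.Lmodule.sort ?A ?M =>
      let l0 := constr:(@nil M) in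
      let l1 := lmod_atoms x l0 in let l := lmod_atoms y l1 in
      let e1 := lmod_reify A x l in let e2 := lmod_reify A y l in
      apply: (@leval_eq A M l e1 e2); rewrite /=; do ?split; ring
    end
  end.

(** * Submodules and finite generation *)

Definition smem (A : comPzRingType) (M : lmodType A) (N : submodule M) (x : M)
  : Prop := submodule_set N x.
Coercion smem : submodule >-> Funclass.

Definition sle (A : comPzRingType) (M : lmodType A) (X Y : submodule M) :=
  forall x, X x -> Y x.
Notation "X <=s Y" := (sle X Y) (at level 70, no associativity).

Section SubmoduleLattice.
Variables (A : comPzRingType) (M : lmodType A).
Implicit Types (X Y Z U V : submodule M) (s t : seq M) (x y z : M).

Lemma smem_lin X a x y : X x -> X y -> X (a *: x + y).
Proof.
move=> Xx Xy; have [_ lin] := submodule_closed X.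
by have:= lin a x y; rewrite !inE; apply.
Qed.

Lemma smem0 X : X 0.
Proof. by have [X0 _] := submodule_closed X; move: X0; rewrite inE. Qed.

Lemma smemZ X a x : X x -> X (a *: x).
Proof. by move=> Xx; have:= smem_lin a Xx (smem0 X); rewrite addr0. Qed.

Lemma smemD X x y : X x -> X y -> X (x + y).
Proof. by move=> Xx Xy; have:= smem_lin 1 Xx Xy; rewrite scale1r. Qed.

Lemma smemN X x : X x -> X (- x).
Proof. by move=> Xx; rewrite -scaleN1r; apply: smemZ. Qed.

Lemma smemB X x y : X x -> X y -> X (x - y).
Proof. by move=> Xx Xy; apply: smemD => //; apply: smemN. Qed.

Lemma sub_mk_closed (S : set M) :
  S 0 -> (forall a x y, S x -> S y -> S (a *: x + y)) ->
  submod_closed (mem S).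
Proof.
by move=> S0 lin; split=> [|a x y]; rewrite !inE //; apply: lin.
Qed.

Definition sub_mk (S : set M) (S0 : S 0)
    (Slin : forall a x y, S x -> S y -> S (a *: x + y)) : submodule M :=
  Submodule (sub_mk_closed S0 Slin).

Lemma sub_ext X Y : (forall x, X x <-> Y x) -> X = Y.
Proof.
case: X Y => [X cX] [Y cY] eqXY.
have eqS : X = Y by apply/funext => x; apply/propext; apply: eqXY.
by case: Y / eqS cY {eqXY} => cY; congr Submodule; apply: Prop_irrelevance.
Qed.

Lemma sle_refl X : X <=s X. Proof. by []. Qed.

Lemma sle_trans X Y Z : X <=s Y -> Y <=s Z -> X <=s Z.
Proof. by move=> XY YZ x /XY /YZ. Qed.

Lemma sle_anti X Y : X <=s Y -> Y <=s X -> X = Y.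
Proof. by move=> XY YX; apply: sub_ext => x; split; [apply: XY|apply: YX]. Qed.

Definition szero : submodule M.
Proof.
apply: (@sub_mk [set x : M | x = 0]) => //= a x y -> ->.
by rewrite scaler0 addr0.
Defined.

Definition sfull : submodule M.
Proof. by apply: (@sub_mk [set: M]). Defined.

Definition smeet X Y : submodule M.
Proof.
apply: (@sub_mk [set x : M | X x /\ Y x]) => /=; first by split; apply: smem0.
by move=> a x y [Xx Yx] [Xy Yy]; split; apply: smem_lin.
Defined.

Definition sjoin X Y : submodule M.
Proof.
apply: (@sub_mk [set z : M | exists2 x, X x & exists2 y, Y y & z = x + y]) => /=.
  exists 0; first exact: smem0.
  by exists 0; [exact: smem0|rewrite addr0].
move=> a _ _ [x1 Xx1 [y1 Yy1 ->]] [x2 Xx2 [y2 Yy2 ->]].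
exists (a *: x1 + x2); first exact: smem_lin.
exists (a *: y1 + y2); first exact: smem_lin.
module_ring.
Defined.

Definition adj1 X x : submodule M.
Proof.
apply: (@sub_mk [set y : M | exists a, X (y - a *: x)]) => /=.
  by exists 0; rewrite scale0r subr0; apply: smem0.
move=> a y z [b Xy] [c Xz]; exists (a * b + c).
suff -> : a *: y + z - (a * b + c) *: x = a *: (y - b *: x) + (z - c *: x).
  exact: smem_lin.
module_ring.
Defined.

Definition adj X s := foldr (fun x Y => adj1 Y x) X s.

Fixpoint adjn X (x : nat -> M) n :=
  if n is n'.+1 then adj1 (adjn X x n') (x n') else X.

(** For [X] inside [Y], this is the preimage in [Y] of the kernel of [a] on Y / X; for [X] zero it
    is the [a]-torsion Y[a]. *)
Definition colon X Y (a : A) : submodule M.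
Proof.
apply: (@sub_mk [set y : M | Y y /\ X (a *: y)]) => /=.
  by split; rewrite ?scaler0; apply: smem0.
move=> b y z [Yy Xy] [Yz Xz]; split; first exact: smem_lin.
suff -> : a *: (b *: y + z) = b *: (a *: y) + a *: z by exact: smem_lin.
module_ring.
Defined.

Lemma homo_sle (F : nat -> submodule M) :
  (forall i, F i <=s F i.+1) -> forall i j, (i <= j)%N -> F i <=s F j.
Proof.
by move=> leF i j le_ij; rewrite -(subnKC le_ij); elim: (j - i)%N => [|k IH];
  rewrite ?addn0 // addnS; apply: sle_trans IH (leF _).
Qed.

Definition sub_bigcup (F : nat -> submodule M)
  (leF : forall i, F i <=s F i.+1) : submodule M.
Proof.
apply: (@sub_mk [set x : M | exists i, F i x]) => /=.
  by exists 0%N; apply: smem0.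
move=> a x y [i Fx] [j Fy]; exists (maxn i j).
by apply: smem_lin; [apply: homo_sle Fx|apply: homo_sle Fy] => //;
  [apply: leq_maxl|apply: leq_maxr].
Defined.

Lemma sub_bigcupE (F : nat -> submodule M) (leF : forall i, F i <=s F i.+1) x :
  sub_bigcup leF x = exists i, F i x.
Proof. by []. Qed.

Definition sub_bigcap (F : nat -> submodule M) : submodule M.
Proof.
apply: (@sub_mk [set x : M | forall i, F i x]) => /= [i|a x y Fx Fy i].
  exact: smem0.
exact: smem_lin.
Defined.

Lemma smeet_l X Y : smeet X Y <=s X. Proof. by move=> x []. Qed.

Lemma smeet_r X Y : smeet X Y <=s Y. Proof. by move=> x []. Qed.

Lemma smeet_idl X Y : X <=s Y -> smeet X Y = X.
Proof. by move=> XY; apply: sub_ext => x; split=> [[]|Xx] //; split; auto. Qed.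

Lemma smeetC X Y : smeet X Y = smeet Y X.
Proof. by apply: sub_ext => x; split=> -[]. Qed.

Lemma sjoin_l X Y : X <=s sjoin X Y.
Proof.
by move=> x Xx; exists x => //; exists 0; [exact: smem0|rewrite addr0].
Qed.

Lemma sjoin_r X Y : Y <=s sjoin X Y.
Proof.
by move=> y Yy; exists 0; [exact: smem0|exists y; rewrite ?add0r].
Qed.

Lemma sjoin_le X Y Z : X <=s Z -> Y <=s Z -> sjoin X Y <=s Z.
Proof. by move=> XZ YZ _ [x Xx [y Yy ->]]; apply: smemD; auto. Qed.

Lemma sjoinC X Y : sjoin X Y = sjoin Y X.
Proof.
by apply: sle_anti; apply: sjoin_le; try exact: sjoin_l; try exact: sjoin_r.
Qed.

Lemma sjoin_idl X Y : X <=s Y -> sjoin X Y = Y.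
Proof. by move=> XY; apply: sle_anti; [exact: sjoin_le|exact: sjoin_r]. Qed.

Lemma smodular X Y Z : X <=s Z -> smeet (sjoin X Y) Z = sjoin X (smeet Y Z).
Proof.
move=> XZ; apply: sub_ext => z; split.
  move=> [[x Xx [y Yy ->]] Zz]; exists x => //; exists y => //; split=> //.
  by rewrite -[y](addKr x); apply: smemD => //; apply/smemN/XZ.
by move=> [x Xx [y [Yy Zy] ->]]; split; [exists x => //; exists y|apply: smemD; auto].
Qed.

Lemma adj1_le X x : X <=s adj1 X x.
Proof. by move=> y Xy; exists 0; rewrite scale0r subr0. Qed.

Lemma adj1_mem X x : adj1 X x x.
Proof. by exists 1; rewrite scale1r subrr; apply: smem0. Qed.

Lemma adj1_min X Y x : X <=s Y -> Y x -> adj1 X x <=s Y.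
Proof.
move=> XY Yx y [a /XY Yy]; rewrite -(subrK (a *: x) y).
by apply: smemD => //; apply: smemZ.
Qed.

Lemma adj1_mono X Y x : X <=s Y -> adj1 X x <=s adj1 Y x.
Proof. by move=> XY y [a /XY Yy]; exists a. Qed.

Lemma adj_le X s : X <=s adj X s.
Proof. by elim: s => //= x s IH; apply: sle_trans IH (adj1_le _). Qed.

Lemma adj_mem X s x : x \in s -> adj X s x.
Proof.
elim: s => //= y s IH; rewrite inE => /predU1P[->|/IH]; first exact: adj1_mem.
exact: adj1_le.
Qed.

Lemma adj_min X Y s : X <=s Y -> (forall x, x \in s -> Y x) -> adj X s <=s Y.
Proof.
move=> XY; elim: s => //= x s IH Ys; apply: adj1_min.
  by apply: IH => y ys; apply: Ys; rewrite inE ys orbT.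
by apply: Ys; rewrite inE eqxx.
Qed.

Lemma adj_mono X Y s : X <=s Y -> adj X s <=s adj Y s.
Proof.
by move=> XY; apply: adj_min; [apply: sle_trans XY (adj_le _)|apply: adj_mem].
Qed.

Lemma adj_cat X s t : adj X (s ++ t) = adj (adj X t) s.
Proof. exact: foldr_cat. Qed.

Lemma adjn_homo X (x : nat -> M) i j : (i <= j)%N -> adjn X x i <=s adjn X x j.
Proof. by apply: homo_sle => k; apply: adj1_le. Qed.

Lemma adjn_mem X (x : nat -> M) i n : (i < n)%N -> adjn X x n (x i).
Proof. by move=> lt_in; apply: (adjn_homo lt_in); apply: adj1_mem. Qed.

Lemma adjn_min X Y (x : nat -> M) n :
  X <=s Y -> (forall i, (i < n)%N -> Y (x i)) -> adjn X x n <=s Y.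
Proof.
move=> XY; elim: n => //= n IH Yx; apply: adj1_min; last exact: Yx.
by apply: IH => i lt_in; apply: Yx; rewrite ltnS ltnW.
Qed.

(** Finite generation of Y / X, including the inclusion of [X] in [Y]. *)
Definition fg X Y := exists s, Y = adj X s.

Lemma fg_le X Y : fg X Y -> X <=s Y.
Proof. by case=> s ->; apply: adj_le. Qed.

Lemma fg_refl X : fg X X. Proof. by exists [::]. Qed.

Lemma fg_adj1 X x : fg X (adj1 X x). Proof. by exists [:: x]. Qed.

Lemma fg_trans Y X Z : fg X Y -> fg Y Z -> fg X Z.
Proof. by move=> [s ->] [t ->]; exists (t ++ s); rewrite adj_cat. Qed.

Lemma fg_top X Z Y : fg X Y -> X <=s Z -> Z <=s Y -> fg Z Y.
Proof.
move=> [s ->] XZ ZY; exists s; apply: sle_anti; first exact: adj_mono.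
by apply: adj_min => // x; apply: adj_mem.
Qed.

(** Each generator of [Y] over [X] can be corrected by an element of [X] so as to lie in [V]. *)
Lemma fg_gens X V Y : fg X Y -> Y <=s sjoin X V ->
  exists2 s, (forall x, x \in s -> V x) & Y <=s adj X s.
Proof.
move=> [s ->]; elim: s => [|x s IH] YXV.
  by exists [::] => //; apply: sle_refl.
have [|t Vt le_t] := IH; first by apply: sle_trans YXV; apply: adj1_le.
have [y Xy [v Vv def_x]] := YXV x (adj1_mem _ _).
exists (v :: t) => [z|]; first by rewrite inE => /predU1P[->|/Vt].
apply: adj1_min; first by apply: sle_trans le_t _; apply: adj1_le.
rewrite def_x; apply: smemD; last exact: adj1_mem.
by apply: adj1_le; apply: adj_le.
Qed.

Lemma adj_split X s y : adj X s y ->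
  exists2 x, X x & adj szero s (y - x).
Proof.
elim: s y => [y Xy|z s IH y [a /IH[x Xx xs]]] /=.
  by exists y => //; rewrite /= subrr.
by exists x => //; exists a; rewrite (addrAC y).
Qed.

(** Second isomorphism theorem: V / (X /\ V) is isomorphic to (X + V) / X. *)
Lemma fg_iso2 X V : fg (smeet X V) V <-> fg X (sjoin X V).
Proof.
split=> [[s def_V]|fgXV].
  exists s; apply: sle_anti.
    apply: sjoin_le; first exact: adj_le.
    by rewrite {1}def_V; apply: adj_mono; apply: smeet_l.
  apply: adj_min; first exact: sjoin_l.
  by move=> x xs; apply: sjoin_r; rewrite def_V; apply: adj_mem.
have [s Vs le_s] := fg_gens fgXV (@sle_refl _).
exists s; apply: sle_anti; last by apply: adj_min => //; apply: smeet_r.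
move=> v Vv; have [x Xx xs] := adj_split (le_s v (@sjoin_r X V v Vv)).
have Vx : V (v - x) by apply: (adj_min _ Vs) xs => _ ->; apply: smem0.
rewrite -(subrK x v); apply: smemD.
  by apply: adj_mono xs => _ ->; apply: smem0.
apply: adj_le; split=> //; rewrite -[x](subKr v); exact: smemB.
Qed.

Lemma fg_add X Y Z : fg X Y -> fg (sjoin X Z) (sjoin Y Z).
Proof.
move=> [s def_Y]; exists s; apply: sle_anti.
  apply: sjoin_le; last by apply: sle_trans (adj_le _); apply: sjoin_r.
  by rewrite def_Y; apply: adj_mono; apply: sjoin_l.
apply: adj_min => [|x xs].
  apply: sjoin_le; last exact: sjoin_r.
  by apply: sle_trans (@sjoin_l _ _); rewrite def_Y; apply: adj_le.
by apply: sjoin_l; rewrite def_Y; apply: adj_mem.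
Qed.

Lemma not_fg_seq X Y : X <=s Y -> ~ fg X Y ->
  exists x : nat -> M, forall n, Y (x n) /\ ~ adjn X x n (x n).
Proof.
move=> XY nfg.
(* The condition on [s] sits under the existential so that choice yields a function on all lists; 0
   is the default value. *)
have next (s : seq M) : exists x, (forall y, y \in s -> Y y) ->
    Y x /\ ~ adj X s x.
  have [Ys|nYs] := pselect (forall y, y \in s -> Y y); last by exists 0.
  apply: contrapT => /forallNP nY; apply: nfg; exists s; apply: sle_anti => [x Yx|].
    by apply: contrapT => nx; case: (nY x).
  exact: adj_min.
have [f fP] := choice next.
pose S := fix S n := if n is n'.+1 then f (S n') :: S n' else [::].
exists (fun n => f (S n)) => n.
have -> : adjn X (fun n => f (S n)) n = adj X (S n).
  by elim: n => //= n ->.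
apply: (fP (S n)); elim: n => //= n IH y; rewrite inE => /predU1P[->|/IH //].
by have [] := fP (S n) IH.
Qed.

End SubmoduleLattice.

(** * Finite generation over a noetherian ring *)

Section Noetherian.
Variables (A : comPzRingType) (A_noetherian : ring_noetherian A).

Lemma acc_fg (M : lmodType A) (X Y : submodule M) :
  (forall N : nat -> submodule M, (forall i, N i <=s N i.+1) ->
     (forall i, X <=s N i /\ N i <=s Y) -> exists n, N n.+1 = N n) ->
  X <=s Y -> fg X Y.
Proof.
move=> acc XY; apply: contrapT => /(not_fg_seq XY)[x xP].
have [|n|n def_n] := acc (adjn X x); first by move=> i; apply: adj1_le.
  split; first exact: (@adjn_homo _ _ _ _ 0).
  by apply: adjn_min => // i _; case: (xP i).
by case: (xP n) => _; apply; rewrite -def_n; apply: adj1_mem.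
Qed.

Lemma ideal_fg (I : submodule A^o) : fg (szero _) I.
Proof.
apply: acc_fg => [N leN _|_ ->]; last exact: smem0.
by have [n eqN] := A_noetherian leN; exists n; apply: eqN.
Qed.

Variable M : lmodType A.
Implicit Types (X Y Z U V : submodule M) (x y z : M).

(** The colon ideal (X + Y : x), phrased so that each of its elements comes with a lift to [Y]. *)
Definition quot_ideal X Y x : submodule A^o.
Proof.
apply: (@sub_mk _ A^o [set r : A | exists2 y, Y y & X (y - r *: x)]) => /=.
  by exists 0; rewrite ?scale0r ?subr0; apply: smem0.
move=> a r t [y Yy Xy] [z Yz Xz]; exists (a *: y + z); first exact: smem_lin.
have lin (b c : A) : a *: y + z - (a * b + c) *: x =
    a *: (y - b *: x) + (z - c *: x) by module_ring.
by have:= smem_lin a Xy Xz; rewrite -lin; apply.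
Defined.

(** Hilbert's argument, by induction on the generators: with [W] spanned by all generators but [x],
    generators of the trace of [Z] on [W] are completed by lifts of generators of the ideal of
    [x]-coefficients of elements of [Z]. *)
Lemma fg_sub X Y Z : fg X Y -> X <=s Z -> Z <=s Y -> fg X Z.
Proof.
move=> [s ->]; elim: s Z => [|x s IH] Z XZ ZY.
  by rewrite (sle_anti XZ ZY); exists [::].
set W := adj X s in IH *.
have fgXW : fg X (smeet W Z).
  by apply: IH; [move=> z Xz; split; [apply: adj_le|apply: XZ]|apply: smeet_l].
apply: fg_trans fgXW _.
have [t def_t] := ideal_fg (quot_ideal W Z x).
have lift r : exists y, quot_ideal W Z x r -> Z y /\ W (y - r *: x).
  have [[y Zy Wy]|nr] := pselect (quot_ideal W Z x r); first by exists y.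
  by exists 0.
have [f fP] := choice lift.
exists (map f t); apply: sle_anti => [z Zz|]; last first.
  apply: adj_min => [|_ /mapP[r rt ->]]; first exact: smeet_r.
  by case: (fP r) => //; rewrite def_t; apply: adj_mem.
have [r Wr] := ZY z Zz.
have: quot_ideal W Z x r by exists z.
rewrite def_t.
have: forall r, r \in t -> quot_ideal W Z x r.
  by move=> q qt; rewrite def_t; apply: adj_mem.
move=> {def_t} tP.
(* Subtracting multiples of the lifts reduces the coefficient of [x] to zero, which leaves an
   element of [W] and [Z]. *)
elim: t tP z r Wr Zz => [|q t IHt] tP z r Wr Zz /= => [r0|[b tr]].
  split=> //; have r0' : r = 0 by exact: r0.
  by move: Wr; rewrite r0' scale0r subr0.
have [Zq Wq] := fP q (tP q (mem_head _ _)).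
exists b; apply: (IHt _ _ (r - b * q)).
- by move=> p pt; apply: tP; rewrite inE pt orbT.
- suff -> : z - b *: f q - (r - b * q) *: x =
            (z - r *: x) - b *: (f q - q *: x).
    by apply: smemB => //; apply: smemZ.
  module_ring.
- by apply: smemB => //; apply: smemZ.
- exact: tr.
Qed.

(** (Y /\ Z) / (X /\ Z) embeds into Y / X. *)
Lemma fg_meet X Y Z : fg X Y -> fg (smeet X Z) (smeet Y Z).
Proof.
move=> fgXY; have leXY := fg_le fgXY.
have -> : smeet X Z = smeet X (smeet Y Z).
  apply: sub_ext => x; split=> [[Xx Zx]|[Xx [_ Zx]]] //.
  by do 2?split=> //; apply: leXY.
apply/fg_iso2; apply: fg_sub fgXY _ _; first exact: sjoin_l.
by apply: sjoin_le => //; apply: smeet_l.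
Qed.

(** Y / X is an extension of (Y + U) / (X + U) by (Y /\ U) / (X /\ U); the intermediate module is (X
    + U) /\ Y. *)
Lemma fg_ext U X Y : X <=s Y -> fg (smeet X U) (smeet Y U) ->
  fg (sjoin X U) (sjoin Y U) -> fg X Y.
Proof.
move=> XY fgI fgD.
have: fg (smeet (sjoin X U) Y) Y.
  apply/fg_iso2; suff -> : sjoin (sjoin X U) Y = sjoin Y U by [].
  apply: sle_anti; repeat apply: sjoin_le.
  - by move=> x /XY Yx; apply: sjoin_l.
  - exact: sjoin_r.
  - exact: sjoin_l.
  - exact: sjoin_r.
  - by move=> u Uu; apply: sjoin_l; apply: sjoin_r.
apply: fg_trans; rewrite smodular //; apply/fg_iso2.
have -> : smeet X (smeet U Y) = smeet X U.
  apply: sub_ext => x; split=> [[Xx [Ux _]]|[Xx Ux]] //.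
  by do 2?split=> //; apply: XY.
by rewrite (smeetC U).
Qed.

Lemma acc_max (P : submodule M -> Prop) X Y Z : fg X Y -> P Z ->
  (forall Z, P Z -> X <=s Z /\ Z <=s Y) ->
  exists2 W, P W & forall W', P W' -> W <=s W' -> W' = W.
Proof.
move=> fgXY PZ Pb; apply: contrapT => nmax.
have next (W : {W | P W}) : {W' : {W | P W} |
    sval W <=s sval W' /\ ~ sval W' <=s sval W}.
  apply: cid; case: W => W PW /=; apply: contrapT => nW; apply: nmax; exists W => // W' PW' WW'.
  apply: contrapT => neW; apply: nW; exists (exist _ W' PW') => /=; split=> //.
  by move=> W'W; apply: neW; apply: sle_anti.
have [f [_ fP]] := dependent_choice next (exist _ Z PZ).
have leF i : sval (f i) <=s sval (f i.+1) by case: (fP i).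
pose W := sub_bigcup leF.
have [s def_W] : fg X W.
  apply: (fg_sub fgXY) => [x Xx|x]; last first.
    by rewrite /W sub_bigcupE => -[i]; apply: (Pb _ (svalP (f i))).2.
  by exists 0%N; apply: (Pb _ (svalP (f 0%N))).1.
have [n sn] : exists n, forall x, x \in s -> sval (f n) x.
  have: forall x, x \in s -> W x by move=> x; rewrite def_W; apply: adj_mem.
  elim: (s) => [|y t IH] Wt; first by exists 0%N.
  have [i fy] := Wt y (mem_head _ _).
  have [|n nt] := IH; first by move=> x xt; apply: Wt; rewrite inE xt orbT.
  exists (maxn i n) => x; rewrite inE => /predU1P[->|/nt].
    by apply: (homo_sle leF) fy; apply: leq_maxl.
  by apply: (homo_sle leF); apply: leq_maxr.
have [_] := fP n; apply=> x fx.
have: W x by exists n.+1.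
by rewrite def_W; apply: adj_min => //; apply: (Pb _ (svalP (f n))).1.
Qed.

Lemma acc_max0 (P : submodule M -> Prop) Y Z : fg (szero M) Y -> P Z ->
  (forall Z, P Z -> Z <=s Y) ->
  exists2 W, P W & forall W', P W' -> W <=s W' -> W' = W.
Proof.
move=> fgY PZ PY; apply: (acc_max fgY PZ) => W PW; split; last exact: PY.
by move=> _ ->; apply: smem0.
Qed.

End Noetherian.

Lemma ideal_max (A : comPzRingType) (A_noetherian : ring_noetherian A)
    (P : submodule A^o -> Prop) Z : P Z ->
  exists2 W, P W & forall W', P W' -> W <=s W' -> W' = W.
Proof.
move=> PZ.
apply: (acc_max A_noetherian (ideal_fg A_noetherian (@sfull _ _)) PZ) => W _.
by split=> [_ ->|//]; apply: smem0.
Qed.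

Section Artinian.
Variables (A : comPzRingType) (M : lmodType A).
Implicit Types (X Y Z : submodule M).

Lemma dcc_min (P : submodule M -> Prop) Z : module_artinian M -> P Z ->
  exists2 W, P W & forall W', P W' -> W' <=s W -> W' = W.
Proof.
move=> art PZ; apply: contrapT => nmin.
have next (W : {W | P W}) : {W' : {W | P W} |
    sval W' <=s sval W /\ ~ sval W <=s sval W'}.
  apply: cid; case: W => W PW /=; apply: contrapT => nW; apply: nmin; exists W => // W' PW' WW'.
  apply: contrapT => neW; apply: nW; exists (exist _ W' PW') => /=; split=> //.
  by move=> W'W; apply: neW; apply: sle_anti.
have [f [_ fP]] := dependent_choice next (exist _ Z PZ).
have [|n eqf] := art (fun i => sval (f i)); first by move=> i; case: (fP i).
by have [_] := fP n; apply; rewrite (eqf n.+1).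
Qed.

End Artinian.

(** * Images, devissage of artinian modules *)

Definition mk_linear (A : pzRingType) (U V : lmodType A) (f : U -> V)
    (lin_f : linear f) : {linear U -> V} :=
  HB.pack f (GRing.isLinear.Build A U V _ f lin_f).

Section Images.
Variables (A : comPzRingType) (M Q : lmodType A) (p : {linear M -> Q}).
Implicit Types (X Y Z : submodule M) (W : submodule Q).

Definition sub_img X : submodule Q.
Proof.
apply: (@sub_mk _ _ [set y : Q | exists2 x, X x & y = p x]) => /=.
  by exists 0; [exact: smem0|rewrite linear0].
move=> a _ _ [x Xx ->] [y Xy ->]; exists (a *: x + y); first exact: smem_lin.
by rewrite linearP.
Defined.

Definition sub_pre W : submodule M.
Proof.
apply: (@sub_mk _ _ [set x : M | W (p x)]) => /=.
  by rewrite linear0; apply: smem0.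
by move=> a x y Wx Wy; rewrite linearP; apply: smem_lin.
Defined.

Definition sub_ker : submodule M := sub_pre (@szero A Q).

Lemma sub_img_mem X x : X x -> sub_img X (p x). Proof. by exists x. Qed.

Lemma sub_img_mono X Y : X <=s Y -> sub_img X <=s sub_img Y.
Proof. by move=> XY _ [x /XY Yx ->]; exists x. Qed.

Lemma sub_pre_img X : sub_pre (sub_img X) = sjoin X sub_ker.
Proof.
apply: sub_ext => x; split=> [[y Xy eq_p]|[y Xy [z kz ->]]].
  exists y => //; exists (x - y); last by rewrite addrC subrK.
  by change (p (x - y) = 0); rewrite linearB /= eq_p subrr.
exists y => //; rewrite linearD; have -> : p z = 0 by exact: kz.
by rewrite addr0.
Qed.

Lemma sub_img_adj X s : sub_img (adj X s) = adj (sub_img X) (map p s).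
Proof.
elim: s => //= x s IH; rewrite -IH; apply: sub_ext => y; split.
  move=> [z [a az] ->]; exists a; exists (z - a *: x) => //.
  by rewrite raddfB /= linearZ_LR.
move=> [a [z Xz def_z]]; exists (z + a *: x).
  by exists a; rewrite addrK.
by rewrite linearD linearZ /= -def_z subrK.
Qed.

Lemma fg_img_inv X Y : X <=s Y -> fg (sub_img X) (sub_img Y) ->
  fg (sjoin X sub_ker) (sjoin Y sub_ker).
Proof.
move=> XY [t def_t].
have [s Ys def_s] : exists2 s, (forall x, x \in s -> Y x) & t = map p s.
  have: forall y, y \in t -> sub_img Y y by move=> y yt; rewrite def_t; apply: adj_mem.
  elim: (t) => [|y u IH] Yt; first by exists [::].
  have [|s Ys ->] := IH; first by move=> x xu; apply: Yt; rewrite inE xu orbT.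
  have [x Yx ->] := Yt y (mem_head _ _); exists (x :: s) => // z.
  by rewrite inE => /predU1P[->|/Ys].
exists s; apply: sle_anti; last first.
  apply: adj_min => [|x /Ys Yx]; last exact: sjoin_l.
  apply: sjoin_le; last exact: sjoin_r.
  by move=> x /XY Yx; apply: sjoin_l.
apply: sjoin_le => [y Yy|]; last first.
  by move=> y ky; apply: adj_le; apply: sjoin_r.
have: sub_pre (sub_img (adj X s)) y.
  by rewrite /sub_pre sub_img_adj -def_s -def_t; exists y.
rewrite sub_pre_img; apply: sjoin_le.
  by apply: adj_mono; apply: sjoin_l.
by move=> z kz; apply: adj_le; apply: sjoin_r.
Qed.

(** Y / X is an extension of p(Y) / p(X) by the quotient of the traces on the kernel. *)
Lemma fg_img_ext X Y : X <=s Y ->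
  fg (sub_img X) (sub_img Y) -> fg (smeet X sub_ker) (smeet Y sub_ker) -> fg X Y.
Proof. by move=> XY /(fg_img_inv XY) fgD fgI; apply: fg_ext fgD. Qed.

Hypothesis p_surj : quotient_map p.

Lemma sub_img_pre W : sub_img (sub_pre W) = W.
Proof.
apply: sub_ext => y; split=> [[x Wx ->]//|Wy].
by have [x def_y] := p_surj y; exists x => //; change (W (p x)); rewrite def_y.
Qed.

Lemma sub_pre_inj : injective sub_pre.
Proof. by move=> W W' eqW; rewrite -(sub_img_pre W) eqW sub_img_pre. Qed.

End Images.

Section Scaling.
Variables (A : comPzRingType) (M : lmodType A) (a : A).

Lemma scale_linear : linear (fun x : M => a *: x).
Proof. by move=> b x y; module_ring. Qed.

Definition scale_map : {linear M -> M} := mk_linear scale_linear.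

End Scaling.

Lemma artinian_dcc (A : comPzRingType) (M : lmodType A) (N : nat -> submodule M) :
  module_artinian M -> (forall i, N i.+1 <=s N i) ->
  exists n, forall m, (n <= m)%N -> N m = N n.
Proof. by move=> art; apply: art. Qed.

(** Y / X behaves as a vector space over the residue field of [m], and the descending chain
    condition bounds its dimension. *)
Lemma residue_module_fg (A : comPzRingType) (M : lmodType A)
    (X Y : submodule M) (m : A -> Prop) :
  module_artinian M -> X <=s Y -> (forall a, ~ m a -> exists s, m (1 - s * a)) ->
  (forall a y, m a -> Y y -> X (a *: y)) -> fg X Y.
Proof.
move=> art XY mmax mY; apply: contrapT => /(not_fg_seq XY)[x xP].
(* [T k] is spanned over [X] by the terms of index at least [k] of an
   independent sequence, so it decreases strictly. *)
have leT k i : adjn X (fun j => x (k + j)%N) i <=s adjn X (fun j => x (k + j)%N) i.+1.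
  exact: adj1_le.
pose T k := sub_bigcup (leT k).
have leS k : T k.+1 <=s T k.
  move=> y; rewrite /T !sub_bigcupE => -[i Ty]; exists i.+1.
  apply: adjn_min Ty => [|j lt_ji]; first by apply: (@adjn_homo _ _ _ _ 0).
  by rewrite addSnnS; apply: (@adjn_mem _ _ _ (fun j => x (k + j)%N)).
have [k eqT] := art T leS.
have : T k.+1 (x k).
  rewrite (eqT k.+1) // /T sub_bigcupE; exists 1%N.
  by rewrite -{2}[k]addn0; apply: (@adjn_mem _ _ _ (fun j => x (k + j)%N)).
rewrite /T sub_bigcupE => -[n]; elim: n => [|n IH] /=.
  by move=> Xk; case: (xP k) => _; apply; apply: (@adjn_homo _ _ _ _ 0).
set z := x (k.+1 + n)%N => -[r].
have [Yz nz] := xP (k.+1 + n)%N; rewrite -/z in Yz nz.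
have [mr|/mmax[s ms]] := pselect (m r).
  move=> Tk; apply: IH; rewrite -(subrK (r *: z) (x k)).
  by apply: smemD => //; apply: (@adjn_homo _ _ _ _ 0) => //; apply: mY.
set w := x k - r *: z => Tw; apply: nz.
have -> : z = s *: x k - s *: w + (1 - s * r) *: z.
  by rewrite /w; module_ring.
apply: smemD; last by apply: (@adjn_homo _ _ _ _ 0) => //; apply: mY.
apply: smemB; apply: smemZ; first by apply: adjn_mem; rewrite addSn ltnS leq_addr.
apply: adjn_min Tw => [|j lt_jn]; first by apply: (@adjn_homo _ _ _ _ 0).
by apply: adjn_mem; rewrite ltn_add2l.
Qed.

Definition annih (A : comPzRingType) (M : lmodType A) (X : submodule M) (x : M)
  : submodule A^o.
Proof.
apply: (@sub_mk _ A^o [set r : A | X (r *: x)]) => /=.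
  by rewrite scale0r; apply: smem0.
move=> a r t Xr Xt.
have lin (b c : A) : (a * b + c) *: x = a *: (b *: x) + c *: x.
  by module_ring.
by have:= smem_lin a Xr Xt; rewrite -lin; apply.
Defined.

Lemma annihE (A : comPzRingType) (M : lmodType A) (X : submodule M) x (r : A) :
  annih X x r = X (r *: x).
Proof. by []. Qed.

Section Devissage.
Variables (A : comPzRingType) (Q : lmodType A) (art : module_artinian Q).
Implicit Types (X Y : submodule Q) (a : A).

Definition torsion_part X a : submodule Q.
Proof.
apply: (@sub_mk _ _ [set x : Q | X x /\ exists n, a ^+ n *: x = 0]) => /=.
  by split; [exact: smem0|exists 0%N; rewrite scaler0].
move=> b x y [Xx [i ax]] [Xy [j ay]]; split; first exact: smem_lin.
exists (i + j)%N; have -> : a ^+ (i + j) *: (b *: x + y) =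
    (b * a ^+ j) *: (a ^+ i *: x) + a ^+ i *: (a ^+ j *: y).
  by rewrite exprD; module_ring.
by rewrite ax ay !scaler0 addr0.
Defined.

Definition unit_part X a : submodule Q.
Proof.
apply: (@sub_mk _ _ [set x : Q | X x /\ exists t, (t * a) *: x = x]) => /=.
  by split; [exact: smem0|exists 0; rewrite scaler0].
move=> b x y [Xx [t tx]] [Xy [s sy]]; split; first exact: smem_lin.
(* One minus the new multiple of [a] is (1 - ta)(1 - sa), which kills both [x] and [y]. *)
exists (t + s - t * s * a).
have -> : ((t + s - t * s * a) * a) *: (b *: x + y) =
    b *: ((t * a) *: x) + (b * (s * a)) *: (x - (t * a) *: x) +
    ((s * a) *: y + (t * a) *: (y - (s * a) *: y)) by module_ring.
by rewrite tx sy !subrr !scaler0 !addr0.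
Defined.

(** The submodules generated by the elements a^n x stabilize, so a^n x = r a^(n+1) x for some [n]
    and [r]; then (ra)^n x is the component on which [a] is invertible. *)
Lemma fitting X a : X <=s sjoin (torsion_part X a) (unit_part X a).
Proof.
move=> x Xx.
have [|n eqC] := artinian_dcc (N := fun n => adj1 (@szero _ _) (a ^+ n *: x)) art.
  move=> i; apply: adj1_min; first by move=> _ ->; apply: smem0.
  by rewrite exprS -scalerA; apply: smemZ; apply: adj1_mem.
have [r r0] : adj1 (@szero _ _) (a ^+ n.+1 *: x) (a ^+ n *: x).
  by rewrite eqC //; apply: adj1_mem.
have eq_r : (r * a) *: (a ^+ n *: x) = a ^+ n *: x.
  apply/eqP; rewrite eq_sym -subr_eq0; apply/eqP.
  have -> : (r * a) *: (a ^+ n *: x) = r *: (a ^+ n.+1 *: x).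
    by rewrite exprS; module_ring.
  exact: r0.
have eq_rk k : (r * a) ^+ k *: (a ^+ n *: x) = a ^+ n *: x.
  by elim: k => [|k IH]; rewrite ?scale1r // exprSr -scalerA eq_r.
exists (x - (r * a) ^+ n *: x).
  split; first by apply: smemB => //; apply: smemZ.
  exists n; have -> : a ^+ n *: (x - (r * a) ^+ n *: x) =
      a ^+ n *: x - (r * a) ^+ n *: (a ^+ n *: x) by module_ring.
  by rewrite eq_rk subrr.
exists ((r * a) ^+ n *: x); last by rewrite subrK.
split; first exact: smemZ.
exists r; have -> : (r * a) *: ((r * a) ^+ n *: x) =
    r ^+ n *: ((r * a) *: (a ^+ n *: x)) by rewrite exprMn; module_ring.
by rewrite eq_r exprMn scalerA.
Qed.

(* For minimal [X], the decomposition of [fitting] is trivial for every [a]; the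
   ideal [m] is the annihilator of a simple submodule. *)
Lemma devissage (small : submodule Q -> Prop) :
  (forall X, fg (@szero _ _) X -> small X) ->
  (forall X Y, small X -> small Y -> small (sjoin X Y)) ->
  forall W, ~ small W ->
  exists X (m : submodule A^o),
    [/\ ~ small X,
        forall Y, Y <=s X -> ~ X <=s Y -> small Y,
        forall a, ~ m a -> exists s : A, m (1 - s * a),
        forall a x, m a -> X x -> exists n, a ^+ n *: x = 0 &
        exists a x, [/\ m a, X x & a *: x <> 0]].
Proof.
move=> small_fg smallD W nsW.
have [X nsX minX] := dcc_min (P := fun X => ~ small X) art nsW.
have smallX Y : Y <=s X -> ~ X <=s Y -> small Y.
  move=> YX nXY; apply: contrapT => nsY; apply: nXY.
  by rewrite (minX Y nsY YX).
have nX0 : ~ X <=s @szero _ _.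
  move=> X0; apply: nsX; apply: small_fg.
  by rewrite (_ : X = @szero _ _); [exact: fg_refl|apply: sle_anti => // _ ->; apply: smem0].
have [S [SX nS0] minS] := dcc_min (P := fun S => S <=s X /\ ~ S <=s @szero _ _)
  art (conj (@sle_refl _ _ X) nX0).
have [x0 Sx0 nz_x0] : exists2 x, S x & x <> 0.
  apply: contrapT => /forall2NP nS; apply: nS0 => x Sx.
  by apply: contrapT => nx; case: (nS x).
pose m := annih (@szero _ Q) x0.
have mmax a : ~ m a -> exists s : A, m (1 - s * a).
  move=> nma; have Sa : adj1 (@szero _ _) (a *: x0) <=s S.
    by apply: adj1_min; [move=> _ ->; apply: smem0|apply: smemZ].
  have: adj1 (@szero _ _) (a *: x0) x0.
    rewrite (minS _ _ Sa) //; split; first by move=> x /Sa /SX.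
    by move=> /(_ _ (adj1_mem _ _)) ax; apply: nma.
  move=> [s sx]; exists s; rewrite /m annihE.
  by have -> : (1 - s * a) *: x0 = x0 - s *: (a *: x0) by module_ring.
have tors a x : m a -> X x -> exists n, a ^+ n *: x = 0.
  move=> ma Xx; have [|nle] := pselect (X <=s torsion_part X a).
    by move=> /(_ x Xx)[].
  have [Xle|nle'] := pselect (X <=s unit_part X a).
    have [_ [t tx]] := Xle x0 (SX _ Sx0); case: nz_x0; rewrite -tx -scalerA.
    by have -> : a *: x0 = 0 by []; rewrite scaler0.
  case: nsX; have -> : X = sjoin (torsion_part X a) (unit_part X a).
    apply: sle_anti; first exact: fitting.
    by apply: sjoin_le => y [].
  by apply: smallD; apply: smallX => // y [].
(* If [m] killed [X], then [X] would be finite dimensional over the residue field, hence small. *)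
exists X, m; split=> //; apply: contrapT => nm; apply: nsX; apply: small_fg.
have H := @residue_module_fg A Q (@szero _ _) X m art.
apply: H => [_ ->|a /mmax[s ms]|a y ma Xy].
- exact: smem0.
- by exists s.
- by apply: contrapT => nz; apply: nm; exists a, y.
Qed.

End Devissage.

(** * Quotient modules and trees of submodules *)

Section Quotient.
Variables (A : comPzRingType) (M : lmodType A) (N : submodule M).

(** A canonical representative of the coset: the quotient becomes the subtype of canonical
    representatives and inherits its choice structure from [M]. *)
Definition coset_repr (x : M) : M := choose (fun y : M => `[< N (x - y) >]) x.

Lemma coset_reprP x : N (x - coset_repr x).
Proof.
apply/asboolP; apply: (@chooseP _ (fun y : M => `[< N (x - y) >])).
by apply/asboolP; rewrite subrr; apply: smem0.
Qed.

Lemma coset_repr_eq x y : N (x - y) -> coset_repr x = coset_repr y.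
Proof.
move=> Nxy; rewrite /coset_repr.
have eqP : (fun z : M => `[< N (x - z) >]) =1 (fun z : M => `[< N (y - z) >]).
  move=> z; apply/asbool_equiv_eq; split=> Nz.
    by rewrite -[y - z](subrKA x) -opprB; apply: smemD => //; apply: smemN.
  by rewrite -[x - z](subrKA y); apply: smemD.
rewrite (eq_choose eqP); apply: choose_id; apply/asboolP.
  by rewrite -opprB; apply: smemN.
by rewrite subrr; apply: smem0.
Qed.

Lemma coset_repr_sub x y : coset_repr x = coset_repr y -> N (x - y).
Proof.
move=> eq_r; rewrite -[x - y](subrKA (coset_repr x)) {2}eq_r -opprB.
rewrite -[coset_repr y - y]opprB opprB.
by apply: smemB; apply: coset_reprP.
Qed.

Lemma coset_reprK x : coset_repr (coset_repr x) = coset_repr x.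
Proof. by apply: coset_repr_eq; rewrite -opprB; apply: smemN; apply: coset_reprP. Qed.

Definition quot := {x : M | coset_repr x == x}.
HB.instance Definition _ := Choice.on quot.

Definition to_quot x : quot := exist _ (coset_repr x) (introT eqP (coset_reprK x)).

Lemma to_quotP x y : to_quot x = to_quot y <-> N (x - y).
Proof.
split=> [[/coset_repr_sub] //|Nxy].
by apply: val_inj => /=; apply: coset_repr_eq.
Qed.

Lemma to_quotK (u : quot) : to_quot (val u) = u.
Proof. by apply: val_inj => /=; apply/eqP; apply: (valP u). Qed.

Lemma to_quot_val x : N (val (to_quot x) - x).
Proof. by rewrite -opprB; apply: smemN; apply: coset_reprP. Qed.

Definition quot_add (u v : quot) : quot := to_quot (val u + val v).
Definition quot_opp (u : quot) : quot := to_quot (- val u).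
Definition quot_scale (a : A) (u : quot) : quot := to_quot (a *: val u).

Lemma to_quotD x y : to_quot (x + y) = quot_add (to_quot x) (to_quot y).
Proof.
apply/to_quotP; set x' := val _; set y' := val _.
have -> : x + y - (x' + y') = - (x' - x) - (y' - y) by module_ring.
by apply: smemB; [apply: smemN|]; apply: to_quot_val.
Qed.

Lemma to_quotN x : to_quot (- x) = quot_opp (to_quot x).
Proof.
by apply/to_quotP; rewrite opprK addrC; apply: to_quot_val.
Qed.

Lemma to_quotZ a x : to_quot (a *: x) = quot_scale a (to_quot x).
Proof.
apply/to_quotP; rewrite -scalerBr -opprB; apply/smemZ/smemN.
exact: to_quot_val.
Qed.

Lemma quot_addA : associative quot_add.
Proof.
move=> u v w; rewrite -[u]to_quotK -[v]to_quotK -[w]to_quotK.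
by rewrite -!to_quotD addrA.
Qed.

Lemma quot_addC : commutative quot_add.
Proof. by move=> u v; rewrite /quot_add addrC. Qed.

Lemma quot_add0 : left_id (to_quot 0) quot_add.
Proof. by move=> u; rewrite -[u]to_quotK -to_quotD add0r. Qed.

Lemma quot_addN : left_inverse (to_quot 0) quot_opp quot_add.
Proof. by move=> u; rewrite -[u]to_quotK -to_quotN -to_quotD addNr. Qed.

HB.instance Definition _ :=
  GRing.isZmodule.Build quot quot_addA quot_addC quot_add0 quot_addN.

Lemma quot_scaleA a b u : quot_scale a (quot_scale b u) = quot_scale (a * b) u.
Proof. by rewrite -[u]to_quotK -!to_quotZ scalerA. Qed.

Lemma quot_scale1 : left_id 1 quot_scale.
Proof. by move=> u; rewrite -[u]to_quotK -to_quotZ scale1r. Qed.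

Lemma quot_scaleDr : right_distributive quot_scale +%R.
Proof.
move=> a u v; rewrite -[u]to_quotK -[v]to_quotK.
by rewrite -[_ + _]to_quotD -!to_quotZ scalerDr to_quotD.
Qed.

Lemma quot_scaleDl u : {morph quot_scale^~ u : a b / a + b}.
Proof. by move=> a b; rewrite -[u]to_quotK -!to_quotZ scalerDl to_quotD. Qed.

HB.instance Definition _ := GRing.Zmodule_isLmodule.Build A quot
  quot_scaleA quot_scale1 quot_scaleDr quot_scaleDl.

Lemma to_quot_linear : linear to_quot.
Proof. by move=> a x y; rewrite to_quotD to_quotZ. Qed.

Definition quot_proj : {linear M -> quot} := mk_linear to_quot_linear.

Lemma quot_proj_surj : quotient_map quot_proj.
Proof. by move=> u; exists (val u); apply: to_quotK. Qed.

Lemma quot_proj_eq0 x : quot_proj x = 0 <-> N x.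
Proof. by rewrite -{2}[x]subr0; apply: to_quotP. Qed.

End Quotient.

Lemma quotient_exists (A : comPzRingType) (M : lmodType A) (N : submodule M) :
  exists (Q : lmodType A) (p : {linear M -> Q}),
    quotient_map p /\ sub_ker p = N.
Proof.
exists (quot N), (quot_proj N); split; first exact: quot_proj_surj.
by apply: sub_ext => x; apply: quot_proj_eq0.
Qed.

Definition continuum_submodules (A : comPzRingType) (M : lmodType A) :=
  exists f : set nat -> submodule M, injective f.

(* A binary tree of pairs [L <= N] in which [L] is the trace on [N] of every
   module below it: distinct branches have distinct unions. *)
Lemma continuum_tree (A : comPzRingType) (M : lmodType A)
    (G : submodule M -> submodule M -> Prop) (N0 L0 : submodule M) :
  G N0 L0 -> (forall N L, G N L -> L <=s N) ->
  (forall N L, G N L -> exists N' L1 L2,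
     [/\ N <=s N', G N' L1 /\ smeet L1 N = L, G N' L2 /\ smeet L2 N = L &
         L1 <> L2]) ->
  continuum_submodules M.
Proof.
move=> G0 GLN Gstep.
pose T := {t : submodule M * submodule M | G t.1 t.2}.
have step (t : T) : {f : bool -> T |
    [/\ (sval (f true)).1 = (sval (f false)).1,
        (sval (f true)).2 <> (sval (f false)).2 &
        forall b, (sval t).1 <=s (sval (f b)).1 /\
                  smeet (sval (f b)).2 (sval t).1 = (sval t).2]}.
  apply: cid; case: t => -[N L] /= GNL.
  have [N' [L1 [L2 [leN [G1 I1] [G2 I2] ne12]]]] := Gstep N L GNL.
  exists (fun b => if b then exist _ (N', L1) G1 : T else exist _ (N', L2) G2).
  by split=> // -[].
pose t0 : T := exist _ (N0, L0) G0.
pose st (S : set nat) := fix st n : T :=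
  if n is n'.+1 then sval (step (st n')) `[< S n' >] else t0.
pose N S n := (sval (st S n)).1; pose L S n := (sval (st S n)).2.
have stP S n : N S n <=s N S n.+1 /\ smeet (L S n.+1) (N S n) = L S n.
  by have [_ _ fP] := svalP (step (st S n)); apply: fP.
have leL S n : L S n <=s L S n.+1.
  by have [_ <-] := stP S n; apply: smeet_l.
have leN S : forall i j, (i <= j)%N -> N S i <=s N S j.
  by apply: homo_sle => n; case: (stP S n).
(* Later stages add nothing inside [N S n], since their traces are compatible. *)
have traceL S n x : sub_bigcup (leL S) x -> N S n x -> L S n x.
  move=> [k]; case: (leqP k n) => [le_kn Lx _|lt_nk].
    by apply: (homo_sle (leL S) le_kn).
  rewrite -(subnKC (ltnW lt_nk)); elim: (k - n)%N => [|i IH]; rewrite ?addn0 // addnS.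
  move=> Lx Nx; apply: IH => //; have [_ <-] := stP S (n + i)%N; split=> //.
  by apply: leN Nx; apply: leq_addr.
exists (fun S => sub_bigcup (leL S)) => S S' eqSS'.
have eqL n : N S n = N S' n -> L S n = L S' n.
  move=> eqN; apply: sub_ext => x; split=> Lx; apply: traceL.
  - by rewrite -eqSS'; exists n.
  - by rewrite -eqN; apply: GLN Lx; apply: (svalP (st S n)).
  - by rewrite eqSS'; exists n.
  - by rewrite eqN; apply: GLN Lx; apply: (svalP (st S' n)).
(* The two children share their upper module but have distinct lower modules, while equal unions
   force equal lower modules. *)
have eqst n : st S n = st S' n -> `[< S n >] = `[< S' n >].
  move=> eqst; have: N S n.+1 = N S' n.+1 -> L S n.+1 = L S' n.+1 := eqL n.+1.
  rewrite /N /L /= -eqst; have [eqN neL _] := svalP (step (st S n)).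
  case: asboolP => Sn; case: asboolP => S'n // eqf; exfalso; apply: neL;
  by [apply: eqf|symmetry; apply: eqf].
have eqstn n : st S n = st S' n by elim: n => //= n IH; rewrite -IH eqst.
apply/funext => n; apply/propext; have := eqst n (eqstn n).
by case: asboolP => Sn; case: asboolP.
Qed.

Section Transfer.
Variables (A : comPzRingType) (M Q : lmodType A).

Lemma continuum_inj (g : submodule Q -> submodule M) :
  injective g -> continuum_submodules Q -> continuum_submodules M.
Proof. by move=> g_inj [f f_inj]; exists (g \o f); apply: inj_comp. Qed.

Lemma continuum_quotient (p : {linear M -> Q}) : quotient_map p ->
  continuum_submodules Q -> continuum_submodules M.
Proof. by move=> p_surj; apply: continuum_inj; apply: sub_pre_inj p_surj. Qed.

Definition sub_pre_sub (N : submodule M) (p : {linear submodule_sort N -> Q})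
  (W : submodule Q) : submodule M.
Proof.
apply: (@sub_mk _ _ [set x : M | exists2 u, val u = x & W (p u)]).
  by exists 0; [rewrite raddf0|rewrite linear0; apply: smem0].
move=> a _ _ [u <- Wu] [v <- Wv]; exists (a *: u + v); first by rewrite linearP.
by rewrite linearP; apply: smem_lin.
Defined.

Lemma continuum_subquotient : iso_to_subquotient Q M ->
  continuum_submodules Q -> continuum_submodules M.
Proof.
move=> [N [p p_surj]]; apply: (continuum_inj (g := sub_pre_sub p)) => W W' eqW.
apply: sub_ext => y; have [u <-] := p_surj y.
have mem V : sub_pre_sub p V (val u) <-> V (p u).
  split=> [[v /val_inj->] //|Vu]; first by exists u.
by rewrite -!mem eqW.
Qed.

End Transfer.

(** * Squares of artinian modules of infinite length *)

Section FiniteLength.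
Variables (A : comPzRingType) (A_noetherian : ring_noetherian A).
Variables (M : lmodType A) (art : module_artinian M).
Implicit Types X Y N : submodule M.

Lemma fg_finite_length : fg (@szero A M) (@sfull A M) -> module_finite_length M.
Proof.
(* A strictly increasing [nat]-valued function bounds the length of chains. *)
pose ranked X := exists r : submodule M -> nat, forall N N',
  N <=s N' -> ~ N' <=s N -> N' <=s X -> (r N < r N')%N.
move=> fgT.
have ranked0 : ranked (@szero _ _).
  exists (fun=> 0%N) => N N' _ nNN' N'0; case: nNN' => x /N'0 ->.
  exact: smem0.
have [//|X [r rP] maxX] := acc_max0 A_noetherian fgT ranked0.
have [XT|nXT] := pselect (@sfull _ _ <=s X).
  exists (r X) => n N ltN.
  have leN i : (i <= n)%N -> (i <= r (N i))%N.
    elim: i => // i IH lt_in; have [leNi nle] := ltN i lt_in.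
    by apply: leq_ltn_trans (IH (ltnW lt_in)) (rP _ _ leNi nle _) => x _; apply: XT.
  have [XN|nXN] := pselect (X <=s N n).
    have -> : X = N n by apply: sle_anti => // x _; apply: XT.
    exact: leN.
  apply: leq_trans (leN n (leqnn n)) (ltnW _).
  by apply: rP => // x _; apply: XT.
have [Y [XY nYX] minY] := dcc_min
  (P := fun Y => X <=s Y /\ ~ Y <=s X) art (Z := sfull M) (conj (fun _ _ => I) nXT).
case: nYX; rewrite (maxX Y) //.
(* The rank on [Y] is the rank of the trace on [X], plus one for modules that leave [X]; nothing
   lies strictly between [X] and [Y]. *)
exists (fun N => r (smeet N X) + ~~ `[< N <=s X >])%N => N N' leN nleN N'Y.
have leI : smeet N X <=s smeet N' X by move=> x [/leN ? ?].
have [N'X|nN'X] := asboolP (N' <=s X).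
  have -> : `[< N <=s X >] by apply/asboolP; apply: sle_trans leN _.
  rewrite !addn0; apply: rP; [exact: leI| |exact: smeet_r].
  by rewrite (smeet_idl N'X) => le_I; apply: nleN => z /le_I [].
have [N'I|nN'I] := pselect (smeet N' X <=s smeet N X); last first.
  rewrite -addSn; apply: leq_add; last exact: leq_b1.
  by apply: rP; [exact: leI|exact: nN'I|exact: smeet_r].
have -> : smeet N X = smeet N' X by apply: sle_anti.
have [NX|nNX] := asboolP (N <=s X); first by rewrite addn0 addn1.
(* Here [N] and [N'] have the same trace on [X], and X + N = Y by minimality of [Y], so [N'] is
   contained in [N]. *)
case: nleN => z N'z.
have: sjoin X N z.
  rewrite (minY (sjoin X N)); first exact: N'Y.
    by split; [exact: sjoin_l|move=> XNX; apply: nNX => x Nx; apply/XNX/sjoin_r].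
  by apply: sjoin_le => // x /leN /N'Y.
move=> [x Xx [y Ny def_z]]; rewrite def_z; apply: smemD => //.
have [] // : smeet N X x.
by apply: N'I; split=> //; rewrite -(addrK y x) -def_z; apply: smemB => //; apply: leN.
Qed.

End FiniteLength.

Section Divisible.
Variables (A : comPzRingType) (A_noetherian : ring_noetherian A).
Variables (P : lmodType A) (art : module_artinian P).
Implicit Types X Y : submodule P.

Lemma fg0D X Y : fg (szero P) X -> fg (szero P) Y -> fg (szero P) (sjoin X Y).
Proof.
move=> fgX fgY; apply: (fg_trans fgY).
have:= fg_add Y fgX; rewrite (sjoin_idl (X := szero P)) // => _ ->.
exact: smem0.
Qed.

Lemma torsion_socle (a : A) n (x : P) : a ^+ n *: x = 0 -> x <> 0 ->
  exists2 k, a ^+ k *: x <> 0 & a ^+ k.+1 *: x = 0.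
Proof.
elim: n => [|n IH]; first by rewrite scale1r.
have [an0|ann0] := pselect (a ^+ n *: x = 0); first by move=> _; apply: IH.
by exists n.
Qed.

(** Truncation of the formal sum of the a^i for i in [S]; on elements killed by a^n, all later
    truncations act alike. *)
Definition series (S : set nat) (a : A) n : A :=
  \sum_(i < n) (if `[< S i >] then a ^+ i else 0).

Lemma series_stable S a n k (x : P) : a ^+ n *: x = 0 ->
  series S a (n + k) *: x = series S a n *: x.
Proof.
move=> anx; elim: k => [|k IH]; rewrite ?addn0 // addnS /series big_ord_recr /=.
rewrite scalerDl -/(series S a _) IH; case: asboolP => _.
  by rewrite addnC exprD -scalerA anx scaler0 addr0.
by rewrite scale0r addr0.
Qed.

Lemma expr_stable (a : A) n k (x : P) : a ^+ n *: x = 0 -> a ^+ (n + k) *: x = 0.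
Proof. by move=> anx; rewrite addnC exprD -scalerA anx scaler0. Qed.

(* The graph of [\sum_(i in S) a^i] on [X], for [a] locally nilpotent on [X]. *)
Definition series_graph X (S : set nat) (a : A) : submodule (P * P)%type.
Proof.
apply: (@sub_mk _ _ [set z : (P * P)%type | X z.1 /\ exists n,
  a ^+ n *: z.1 = 0 /\ z.2 = series S a n *: z.1]) => /=.
  split; first exact: smem0.
  by exists 0%N; rewrite !scaler0.
move=> b [x1 x2] [y1 y2] /= [Xx [i [ax ->]]] [Xy [j [ay ->]]].
split; first exact: smem_lin.
exists (i + j)%N; rewrite -(series_stable S j ax) -(series_stable S i ay) [(j + i)%N]addnC.
split; last by module_ring.
have -> : a ^+ (i + j) *: (b *: x1 + y1) = b *: (a ^+ (i + j) *: x1) + a ^+ (i + j) *: y1.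
  by module_ring.
by rewrite (expr_stable j ax) addnC (expr_stable i ay) scaler0 addr0.
Defined.

(** X[a] is small by minimality, so aX cannot be: [a] is surjective on [X]. A nonzero [e] of X[a]
    can then be divided by a^k, and the value of the series at the quotient shows whether k is in
    [S]. *)
Lemma continuum_square : ~ module_finite_length P ->
  continuum_submodules (P * P)%type.
Proof.
move=> nfl.
have nfg : ~ fg (szero P) (sfull P).
  by move=> fgP; apply: nfl; apply: fg_finite_length.
have [X [m [nfgX smallX _ tors [a [x1 [ma Xx1 ax1]]]]]] :=
  devissage art (fun X fgX => fgX) fg0D nfg.
have a_surj y : X y -> exists2 x, X x & a *: x = y.
  move=> Xy; suff Xle : X <=s sub_img (scale_map P a) X.
    by have [x Xx ->] := Xle y Xy; exists x.
  apply: contrapT => nle; apply: nfgX.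
  apply: (fg_img_ext (p := scale_map P a)); first by move=> _ ->; apply: smem0.
  - have -> : sub_img (scale_map P a) (szero P) = szero P.
      apply: sub_ext => z; split=> [[u -> ->]|->]; first exact: scaler0.
      by exists 0 => //; rewrite linear0.
    apply: smallX => // _ [x Xx ->]; exact: smemZ.
  - have -> : smeet (szero P) (sub_ker (scale_map P a)) = szero P.
      by apply: smeet_idl => _ ->; apply: smem0.
    apply: smallX => [x []//|Xle]; apply: ax1.
    by have [_] := Xle x1 Xx1.
have a_surjn k y : X y -> exists2 x, X x & a ^+ k *: x = y.
  elim: k y => [|k IH] y Xy; first by exists y; rewrite // scale1r.
  have [x /IH[z Xz <-] <-] := a_surj y Xy.
  by exists z; rewrite // scalerA -exprS.
have [e [Xe ae nz_e]] : exists e, [/\ X e, a *: e = 0 & e <> 0].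
  have nz_x1 : x1 <> 0 by move=> x10; apply: ax1; rewrite x10 scaler0.
  have [n anx] := tors a x1 ma Xx1; have [k nz ak] := torsion_socle anx nz_x1.
  by exists (a ^+ k *: x1); split=> //; [exact: smemZ|rewrite scalerA -exprS].
exists (fun S => series_graph X S a) => S S' eqS.
have eq_bit k : (forall i, (i < k)%N -> S i = S' i) -> S k = S' k.
  move=> eq_lt; have [x Xx akx] := a_surjn k e Xe.
  have ak1x : a ^+ k.+1 *: x = 0 by rewrite exprS -scalerA akx.
  have : series_graph X S a (x, series S a k.+1 *: x).
    by split=> //; exists k.+1.
  rewrite eqS => -[_ [n /= [anx]]].
  rewrite -(series_stable S' k.+1 anx) addnC (series_stable S' n ak1x).
  rewrite /series !big_ord_recr /=.
  have -> : \sum_(i < k) (if `[< S i >] then a ^+ i else 0) =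
            \sum_(i < k) (if `[< S' i >] then a ^+ i else 0).
    by apply: eq_bigr => i _; rewrite eq_lt.
  rewrite !scalerDl => /addrI; case: asboolP => Sk; case: asboolP => S'k.
  - by move=> _; apply/propext.
  - by rewrite akx scale0r => /nz_e.
  - by rewrite akx scale0r => /esym/nz_e.
  - by move=> _; apply/propext.
by apply/funext => k; elim/ltn_ind: k => k /eq_bit.
Qed.

End Divisible.

(** * Modules that are not minimax *)

Section Primes.
Variable A : comPzRingType.
Implicit Types (I q : submodule A^o) (a b : A).

Definition prime_ideal q := ~ q 1 /\ forall a b, q (a * b : A) -> q a \/ q b.

(** Invertibility modulo [q] of what lies outside; the unit ideal qualifies, and properness comes
    from primality. *)
Definition maximal_ideal q := forall a, ~ q a -> exists s : A, q (1 - s * a).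

(** The quotient of [A] by the ideal generated by [S] has Krull dimension at most zero. *)
Definition zero_dim (S : A -> Prop) :=
  forall q, prime_ideal q -> (forall a, S a -> q a) -> maximal_ideal q.

Lemma prime_expr q a n : prime_ideal q -> q (a ^+ n : A) -> q a.
Proof.
move=> [q1 qM]; elim: n => [/q1//|n IH]; rewrite exprS => /qM[//|/IH //].
Qed.

Lemma ideal_mul I a b : I b -> I (a * b : A).
Proof. exact: (@smemZ A A^o). Qed.

End Primes.

Section NonMinimax.
Variables (A : comPzRingType) (A_noetherian : ring_noetherian A).
Variable M : lmodType A.
Implicit Types (X Y N L T : submodule M) (q : submodule A^o) (a : A).

Definition kills N L a := forall x, N x -> L (a *: x).

(* [T + a^n E] still meets [N] in [L] when the submodules [{e | a^n e \in T}] have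
   become stationary. *)
Lemma kills_expr_max E N L T a : fg (szero M) E -> N <=s E -> T <=s E ->
  smeet T N = L -> (forall T', T' <=s E -> smeet T' N = L -> T <=s T' -> T' = T) ->
  kills N L a -> exists n, kills E T (a ^+ n).
Proof.
move=> fgE NE TE TN maxT aNL.
pose K i := colon T E (a ^+ i).
have [||_ [n ->] maxK] :=
    acc_max0 A_noetherian (P := fun W => exists i, W = K i) (Z := K 0%N) fgE.
- by exists 0%N.
- by move=> _ [i ->] x [].
have eqK : K n.+1 = K n.
  apply: maxK; first by exists n.+1.
  by move=> x [Ex Tx]; split=> //; rewrite exprS -scalerA; apply: smemZ.
exists n; suff <- : sjoin T (sub_img (scale_map M (a ^+ n)) E) = T.
  by move=> x Ex; apply: sjoin_r; exists x.
apply: maxT; last exact: sjoin_l.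
  by apply: sjoin_le => // _ [x Ex ->]; apply: smemZ.
apply: sub_ext => z; split=> [[[t Tt [_ [e Ee ->] def_z]] Nz]|Lz]; last first.
  by rewrite -TN in Lz; case: Lz => Tz Nz; split=> //; apply: sjoin_l.
have [Tae] : K n e.
  rewrite -eqK; split=> //; rewrite exprS -scalerA.
  have -> : a *: (a ^+ n *: e) = a *: z - a *: t by rewrite def_z /=; module_ring.
  apply: smemB; last exact: smemZ.
  by have := aNL z Nz; rewrite -TN => -[].
by move=> Te; rewrite -TN; split=> //; rewrite def_z; apply: smemD.
Qed.

(* A node of the tree is a pair [L <= N] with [N] finitely generated and [N / L]
   of finite length.  Its two children live on [N + A y] and are a submodule
   maximal among those with trace [L], and a maximal submodule of it. *)
Lemma continuum_non_zero_dim :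
  (forall N, fg (szero M) N -> exists y, ~ @zero_dim A (annih N y)) ->
  continuum_submodules M.
Proof.
move=> nzd.
pose G N L := [/\ fg (szero M) N, L <=s N & zero_dim (kills N L)].
apply: (@continuum_tree _ _ G (szero M) (szero M)).
- split=> //; first exact: fg_refl.
  move=> q [q1 _] killq; case: q1; apply: killq => x ->.
  by rewrite scaler0; apply: smem0.
- by move=> N L [].
move=> N L [fgN LN zdL]; have [y nzd_y] := nzd N fgN.
have [q [pq annq nmax_q]] :
    exists q, [/\ prime_ideal q, forall a, annih N y a -> q a & ~ maximal_ideal q].
  apply: contrapT => /forallNP nq; apply: nzd_y => q pq annq.
  by apply: contrapT => nm; apply: (nq q).
pose E := adj1 N y; have NE : N <=s E by apply: adj1_le.
have fgE : fg (szero M) E by apply: (fg_trans fgN); apply: fg_adj1.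
have [||T [TE TN] maxT] := acc_max0 A_noetherian
    (P := fun T => T <=s E /\ smeet T N = L) (Z := L) fgE.
- by split; [exact: sle_trans LN NE|exact: smeet_idl].
- by move=> T [].
have killT a : kills N L a -> exists n, kills E T (a ^+ n).
  by apply: (kills_expr_max fgE NE TE TN) => T' T'E T'N; apply: maxT.
have LT : L <=s T by rewrite -TN; apply: smeet_l.
(* Otherwise a power of each element killing N / L would send [y] into [N]; so [q] would contain all
   these elements and be maximal. *)
have nTL : ~ T <=s L.
  move=> TL; apply: nmax_q; apply: zdL => // a /killT[n aET].
  apply: (prime_expr (n := n) pq); apply: annq.
  by rewrite annihE; apply/LN/TL/aET/adj1_mem.
have fgLT : fg L T.
  apply: (fg_top (X := szero M)) => //; last by move=> _ ->; apply: smem0.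
  by apply: (fg_sub A_noetherian fgE) => // _ ->; apply: smem0.
have [||T2 [LT2 T2T nTT2] maxT2] := acc_max A_noetherian
  (P := fun T2 => [/\ L <=s T2, T2 <=s T & ~ T <=s T2]) (Z := L) fgLT.
- by split.
- by move=> T2 [].
exists E, T, T2; split=> //.
- split=> //; split=> // q' pq' killq'; apply: zdL => // a /killT[n /killq'].
  exact: prime_expr.
- split; last first.
    apply: sub_ext => x; split=> [[T2x Nx]|Lx].
      by rewrite -TN; split=> //; apply: T2T.
    by split; [apply: LT2|apply: LN].
  split=> //; first exact: sle_trans T2T TE.
  move=> q' pq' killq'.
  have [Iq'|nI] := pselect (forall a, kills N L a -> q' a); first exact: zdL.
  (* Now [q'] contains the annihilator of the simple module T / T2: if [c] kills T / T2, then c a^n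
     kills E / T2. *)
  have [a [/killT[n aET] nq'a]] : exists a, kills N L a /\ ~ q' a.
    apply: contrapT => /forallNP na; apply: nI => a aN; apply: contrapT => nq'a.
    by apply: (na a).
  have [t Tt nT2t] : exists2 t, T t & ~ T2 t.
    apply: contrapT => /forall2NP nt; apply: nTT2 => t Tt.
    by apply: contrapT => nT2t; case: (nt t).
  have eqT : adj1 T2 t = T.
    apply: sle_anti; first exact: adj1_min.
    apply: contrapT => nle; apply: nT2t; rewrite -(maxT2 (adj1 T2 t)); first exact: adj1_mem.
      split=> //; first by apply: sle_trans LT2 _; apply: adj1_le.
      exact: adj1_min.
    exact: adj1_le.
  have annq' c : T2 (c *: t) -> q' c.
    move=> T2c; have cT x : T x -> T2 (c *: x).
      rewrite -eqT => -[r T2x]; rewrite -(subrK (r *: t) x) scalerDr.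
      apply: smemD; first exact: smemZ.
      have -> : c *: (r *: t) = r *: (c *: t) by module_ring.
      exact: smemZ.
    have /pq'.2[//|/(prime_expr pq')//] : q' (c * a ^+ n : A).
    by apply: killq' => x Ex; rewrite -scalerA; apply/cT/aET.
  move=> c nq'c.
  have [s T2s] : adj1 T2 (c *: t) t.
    rewrite (_ : adj1 _ _ = T) //; apply: sle_anti.
      by apply: adj1_min => //; apply: smemZ.
    apply: contrapT => nle; apply: nq'c; apply: annq'.
    rewrite -(maxT2 (adj1 T2 (c *: t))); first exact: adj1_mem.
      split=> //; first by apply: sle_trans LT2 _; apply: adj1_le.
      by apply: adj1_min => //; apply: smemZ.
    exact: adj1_le.
  exists s; apply: annq'.
  by have -> : (1 - s * c) *: t = t - s *: (c *: t) by module_ring.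
- by move=> eqTT2; apply: nTT2; rewrite -eqTT2.
Qed.

(* Modulo the intersection [D] of a strictly decreasing chain, simple modules
   [A y] with [y] deeper and deeper in the chain are independent. *)
Lemma continuum_zero_dim :
  (forall y, @zero_dim A (annih (szero M) y)) -> ~ module_artinian M ->
  continuum_submodules M.
Proof.
move=> zd nart.
have [C [leC ndcc]] : exists C : nat -> submodule M, (forall i, C i.+1 <=s C i) /\
    forall n, exists2 m, (n <= m)%N & C m <> C n.
  apply: contrapT => /forallNP nC; apply: nart => C leC.
  apply: contrapT => /forallNP nn; apply: (nC C); split=> // n.
  apply: contrapT => /forall2NP nm; apply: (nn n) => m le_nm.
  by apply: contrapT => neC; case: (nm m).
have leCn i j : (i <= j)%N -> C j <=s C i.
  move=> le_ij; rewrite -(subnKC le_ij); elim: (j - i)%N => [|k IH]; rewrite ?addn0 // addnS.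
  exact: sle_trans (leC _) IH.
pose D := sub_bigcap C.
have DC i : D <=s C i by move=> x; apply.
pose G N L := [/\ D <=s L, L <=s N & exists i, smeet (C i) N <=s D].
apply: (@continuum_tree _ _ G D D).
- by split=> //; exists 0%N; apply: smeet_r.
- by move=> N L [].
move=> N L [DL LN [i CiN]].
have [x Cx nDx] : exists2 x, C i x & ~ D x.
  apply: contrapT => /forall2NP nx.
  have CD : C i <=s D by move=> x Cx; apply: contrapT => nDx; case: (nx x).
  have [m le_im] := ndcc i; apply; apply: sle_anti; first exact: leCn.
  exact: sle_trans CD (DC m).
(* A maximal annihilator among nonzero multiples of [x] modulo [D] is prime, hence a maximal ideal
   by the dimension hypothesis. *)
pose P (W : submodule A^o) := exists r, [/\ W = annih D (r *: x) & ~ D (r *: x)].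
have [_ [r [-> nDy]] maxW] : exists2 W, P W & forall W', P W' -> W <=s W' -> W' = W.
  apply: (ideal_max A_noetherian (P := P) (Z := annih D (1%R *: x))).
  by exists 1; split=> //; rewrite scale1r.
set y := r *: x in nDy maxW.
have Cy : C i y by apply: smemZ.
have mann : @maximal_ideal A (annih D y).
  apply: (zd x); last first.
    move=> a ax; rewrite annihE /y.
    have -> : a *: (r *: x) = r *: (a *: x) by module_ring.
    have -> : a *: x = 0 by exact: ax.
    by rewrite scaler0; apply: smem0.
  split; first by rewrite annihE scale1r.
  move=> a b; rewrite !annihE -scalerA => Daby.
  have [Dby|nDby] := pselect (D (b *: y)); [by right|left].
  have: annih D (b *: y) a := Daby.
  rewrite (maxW (annih D (b *: y))) //; first by exists (b * r); rewrite -scalerA.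
  move=> c; rewrite !annihE => Dcy.
  have -> : c *: (b *: y) = b *: (c *: y) by module_ring.
  exact: smemZ.
have nNy : ~ N y by move=> Ny; apply: nDy; apply: CiN.
have DN : D <=s N := sle_trans DL LN.
have Ny_ann b : N (b *: y) -> D (b *: y).
  move=> Nby; apply: contrapT => /mann[s]; rewrite annihE => /DN Ns.
  apply: nNy; have -> : y = (1 - s * b) *: y + s *: (b *: y) by module_ring.
  by apply: smemD => //; apply: smemZ.
(* Otherwise [y] can be moved into every [C j] by adding an element of [N]. These corrections agree
   modulo [D], so a single one moves [y] into [D], and [y] is in [N]. *)
have DN' : exists j, smeet (C j) (adj1 N y) <=s D.
  apply: contrapT => /forallNP nj; apply: nNy.
  have shift j : (i <= j)%N -> exists2 n, N n & C j (y + n).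
    move=> le_ij; have [z [[Cz [b Nz]] nDz]] : exists z, smeet (C j) (adj1 N y) z /\ ~ D z.
      apply: contrapT => /forallNP nz; apply: (nj j) => z zP.
      by apply: contrapT => nDz; apply: (nz z).
    have [Dby|/mann[s]] := pselect (annih D y b).
      case: nDz; apply: CiN; split; first exact: leCn Cz.
      by rewrite -(subrK (b *: y) z); apply: smemD => //; apply: DN.
    rewrite annihE => Ds; exists (s *: (z - b *: y)); first exact: smemZ.
    have -> : y + s *: (z - b *: y) = s *: z + (1 - s * b) *: y by module_ring.
    by apply: smemD; [apply: smemZ|apply: DC].
  have [n Nn Cyn] := shift i (leqnn i).
  suff Dyn : D (y + n) by rewrite -(addrK n y); apply: smemB => //; apply: DN.
  move=> j; have [le_ij|/ltnW lt_ji] := leqP i j; last exact: leCn Cyn.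
  have [n' Nn' Cyn'] := shift j le_ij.
  have -> : y + n = (y + n') + (n - n') by module_ring.
  apply: smemD => //; apply: DC; apply: CiN; split; last exact: smemB.
  have -> : n - n' = (y + n) - (y + n') by module_ring.
  by apply: smemB => //; apply: leCn Cyn'.
exists (adj1 N y), L, (adj1 L y); split.
- exact: adj1_le.
- split; last exact: smeet_idl.
  by split=> //; apply: sle_trans LN _; apply: adj1_le.
- split; first by split=> //; [apply: sle_trans DL _; apply: adj1_le|apply: adj1_mono].
  apply: sub_ext => z; split=> [[[b Lz] Nz]|Lz]; last by split; [apply: adj1_le|apply: LN].
  rewrite -(subrK (b *: y) z); apply: smemD => //; apply/DL/Ny_ann.
  by rewrite -[b *: y](subKr z); apply: smemB => //; apply: LN.
- by move=> eqL; apply/nNy/LN; rewrite eqL; apply: adj1_mem.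
Qed.

Lemma fg_noetherian_sort N : fg (szero M) N -> module_noetherian (submodule_sort N).
Proof.
move=> fgN W leW.
have val_lin : linear (val : submodule_sort N -> M) by move=> a u v; rewrite linearP.
pose v := mk_linear val_lin.
have leV i : W i <=s W i.+1 by apply: leW.
pose P V := exists i, V = sub_img v (W i).
have [_ [n ->] maxW] : exists2 V, P V & forall V', P V' -> V <=s V' -> V' = V.
  apply: (acc_max0 A_noetherian (Z := sub_img v (W 0%N)) fgN); first by exists 0%N.
  move=> _ [i ->].
  by move=> _ [u _ ->]; have := valP u; rewrite inE.
exists n => m le_nm.
have eqV : sub_img v (W m) = sub_img v (W n).
  by apply: maxW; [exists m|apply: sub_img_mono; apply: homo_sle leV _ _ le_nm].
apply: sle_anti; last exact: homo_sle leV _ _ le_nm.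
move=> u Wu; have: sub_img v (W n) (val u) by rewrite -eqV; exists u.
by move=> [u' Wu' /val_inj->].
Qed.

End NonMinimax.

Lemma continuum_not_minimax (A : comPzRingType) (M : lmodType A) :
  ring_noetherian A -> ~ module_minimax M -> continuum_submodules M.
Proof.
move=> An nmm.
have [nzd|] := pselect (forall N : submodule M,
    fg (szero M) N -> exists y, ~ @zero_dim A (annih N y)).
  exact: continuum_non_zero_dim.
move=> /existsNP[N /not_implyP[fgN /forallNP zd]].
have [Q [p [p_surj kerp]]] := quotient_exists N.
have pE x : p x = 0 <-> N x by rewrite -kerp.
apply: (continuum_quotient p_surj); apply: (continuum_zero_dim An) => [u|artQ].
  have [y <-] := p_surj u => q pq annq.
  have /contrapT := zd y; apply=> // a; rewrite annihE => /pE pay; apply: annq.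
  by rewrite annihE -linearZ; apply: pay.
apply: nmm; exists Q, p, N; split=> //; last exact: fg_noetherian_sort.
by apply/funext => x; apply/propext; split=> /pE.
Qed.

(** * Artinian modules with a chain of type omega^2 *)

HB.instance Definition _ (A : comPzRingType) (M : lmodType A) :=
  gen_eqMixin (submodule M).

Section PrimeAvoidance.
Variable A : comPzRingType.
Implicit Types (m p q : submodule A^o) (ps : seq (submodule A^o)).

Lemma mem_not_prime m p ps : prime_ideal p -> ~ m <=s p ->
  (forall q, q \in ps -> ~ q <=s p) ->
  exists c : A, [/\ m c, ~ p c & forall q, q \in ps -> q c].
Proof.
have outside q : ~ q <=s p -> exists2 c : A, q c & ~ p c.
  move=> nqp; apply: contrapT => /forall2NP nc; apply: nqp => c qc.
  by apply: contrapT => npc; case: (nc c).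
move=> [_ pM] /outside[c0 mc0 npc0]; elim: ps => [|q ps IH] nps.
  by exists c0; split.
have [|c [mc npc psc]] := IH; first by move=> r r_ps; apply: nps; rewrite inE r_ps orbT.
have [d qd npd] := outside q (nps q (mem_head _ _)).
exists (d * c); split=> [||r]; first exact: ideal_mul.
  by move=> /pM[].
rewrite inE => /predU1P[->|/psc rc]; last exact: ideal_mul.
by rewrite mulrC; apply: ideal_mul.
Qed.

(** Induction on the number of primes. A prime contained in [p] is redundant; if there is none, an
    element avoiding the rest is corrected by an element of [m] outside [p] that lies in all the
    others. *)
Lemma prime_avoidance m ps :
  (forall q, q \in ps -> prime_ideal q /\ ~ m <=s q) ->
  exists2 b : A, m b & forall q, q \in ps -> ~ q b.
Proof.
have [n] := ubnP (size ps); elim: n ps => // n IH [|p ps] ltn psP.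
  by exists 0 => //; apply: (@smem0 A A^o).
have [[q q_ps qp]|/forall2NP nqp] := pselect (exists2 q, q \in ps & q <=s p).
  have [|r|b mb bP] := IH (p :: rem q ps).
  - rewrite /= size_rem //; by case: (ps) q_ps ltn.
  - rewrite inE => /predU1P[->|/mem_rem r_ps]; apply: psP; first exact: mem_head.
    by rewrite inE r_ps orbT.
  exists b => // r; rewrite inE => /predU1P[->|r_ps].
    by apply: bP; apply: mem_head.
  have [->|ne_rq] := eqVneq r q.
    by move=> /qp; apply: bP; apply: mem_head.
  by apply: bP; rewrite inE rem_mem // orbT.
have [|r r_ps|b mb bP] := IH ps; first exact: ltn.
  by apply: psP; rewrite inE r_ps orbT.
have [pb|npb] := pselect (p b); last first.
  by exists b => // r; rewrite inE => /predU1P[->|/bP].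
have [pp nmp] := psP p (mem_head _ _).
have [|c [mc npc psc]] := mem_not_prime pp nmp (ps := ps).
  by move=> q q_ps qp; case: (nqp q).
exists (b + c); first exact: (@smemD A A^o).
move=> r; rewrite inE => /predU1P[->|r_ps] rbc.
  apply: npc; rewrite -(addrK b c) [c + b]addrC.
  exact: (@smemB A A^o).
apply: (bP r r_ps); rewrite -(addrK c b).
by apply: (@smemB A A^o) => //; apply: psc.
Qed.

End PrimeAvoidance.

Section Thin.
Variables (A : comPzRingType) (A_noetherian : ring_noetherian A).
Variables (Q : lmodType A) (art : module_artinian Q).
Implicit Types (X Y Z P U V : submodule Q) (a b c : A).

(** The working form of the absence of chains of type omega^2; the two conditions are compared in
    [thin_no_omega2] and [not_thin_omega2]. *)
Definition thin X := forall N : nat -> submodule Q,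
  (forall i, N i <=s N i.+1) -> (forall i, N i <=s X) ->
  exists n, forall i, (n <= i)%N -> fg (N i) (N i.+1).

Lemma szero_le X : szero Q <=s X. Proof. by move=> _ ->; apply: smem0. Qed.

Lemma fg0_sub X Y : fg (szero Q) Y -> X <=s Y -> fg (szero Q) X.
Proof. by move=> fgY; apply: (fg_sub A_noetherian fgY); apply: szero_le. Qed.

Lemma thin_fg X : fg (szero Q) X -> thin X.
Proof.
move=> fgX N leN NX; exists 0%N => i _.
by apply: (fg_top (fg0_sub fgX (NX i.+1))) => //; apply: szero_le.
Qed.

(** A chain in U + V is controlled by its traces on [U] and its images modulo [U], which are images
    of submodules of [V]. *)
Lemma thinD U V : thin U -> thin V -> thin (sjoin U V).
Proof.
move=> thU thV N leN NUV.
have [||n nP] := thU (fun i => smeet (N i) U).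
- by move=> i x [/leN].
- by move=> i; apply: smeet_r.
have mono i : sjoin (N i) U <=s sjoin (N i.+1) U.
  by apply: sjoin_le; [move=> x /leN; apply: sjoin_l|apply: sjoin_r].
have [||k kP] := thV (fun i => smeet V (sjoin (N i) U)).
- by move=> i x [Vx /mono].
- by move=> i; apply: smeet_l.
have split_N i : sjoin (N i) U = sjoin (smeet V (sjoin (N i) U)) U.
  rewrite [RHS]sjoinC -smodular; last exact: sjoin_r.
  by rewrite smeetC smeet_idl //; apply: sjoin_le; [apply: NUV|apply: sjoin_l].
exists (maxn n k) => i; rewrite geq_max => /andP[le_ni le_ki].
apply: (fg_ext (U := U)) => //; first exact: nP.
by rewrite (split_N i) (split_N i.+1); apply: fg_add; apply: kP.
Qed.

(* An [a]-divisible [a]-torsion module is determined by its [a]-socle, and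
   every submodule is divisible up to something finitely generated. *)
Lemma thin_colon X a : (forall x, X x -> exists n, a ^+ n *: x = 0) ->
  fg (szero Q) (colon (szero Q) X a) -> thin X.
Proof.
move=> tors fgXa N leN NX.
have fgXan n Y : Y <=s X -> fg (szero Q) (colon (szero Q) Y (a ^+ n)).
  move=> YX; apply: (fg0_sub (Y := colon (szero Q) X (a ^+ n))); last first.
    by move=> x [Yx ax]; split=> //; apply: YX.
  elim: n => [|n IH].
    apply: fg0_sub fgXa _ => x [Xx]; rewrite scale1r => ->.
    exact: smem0.
  apply: (fg_img_ext (p := scale_map Q a)); first exact: szero_le.
    have -> : sub_img (scale_map Q a) (szero Q) = szero Q.
      apply: sub_ext => z; split=> [[u -> ->]|->]; first exact: scaler0.
      by exists 0 => //; rewrite linear0.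
    apply: fg0_sub IH _ => _ [x [Xx ax] ->]; split; first exact: smemZ.
    have -> : a ^+ n *: scale_map Q a x = a ^+ n.+1 *: x.
      by rewrite exprSr -scalerA.
    exact: ax.
  have -> : smeet (szero Q) (sub_ker (scale_map Q a)) = szero Q.
    exact/smeet_idl/szero_le.
  by apply: fg0_sub fgXa _ => x [[Xx _] ax].
(* The largest [a]-divisible submodule of [N i]; by the descending chain condition it equals a^n N_i
   for some n. *)
pose D i := sub_bigcap (fun n => sub_img (scale_map Q (a ^+ n)) (N i)).
have stable i : exists n, D i = sub_img (scale_map Q (a ^+ n)) (N i).
  have [|n eqn] := artinian_dcc (N := fun n => sub_img (scale_map Q (a ^+ n)) (N i)) art.
    move=> n _ [x Nx ->]; exists (a *: x); first exact: smemZ.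
    by rewrite /= exprSr scalerA.
  exists n; apply: sle_anti => [x|x Dx k]; first by apply.
  have [le_nk|lt_kn] := leqP n k; first by rewrite eqn.
  case: Dx => y Ny ->; exists (a ^+ (n - k) *: y); first exact: smemZ.
  by rewrite /= scalerA -exprD subnKC // ltnW.
have DN i : D i <=s N i by move=> x /(_ 0%N)[y Ny ->]; rewrite /= scale1r.
have leD i : D i <=s D i.+1.
  by move=> x Dx n; apply: sub_img_mono (leN i) _ (Dx n).
have divD i n x : D i x -> exists2 y, D i y & a ^+ n *: y = x.
  move=> Dx; have [k eqk] := stable i; have [y Ny def_x] := Dx (k + n)%N.
  exists (a ^+ k *: y); first by rewrite eqk; exists y.
  by rewrite def_x /= scalerA -exprD addnC.
have fgDN i : fg (D i) (N i).
  have [n eqn] := stable i.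
  have -> : N i = sjoin (D i) (colon (szero Q) (N i) (a ^+ n)).
    apply: sle_anti; last by apply: sjoin_le => // x [].
    move=> x Nx; have [y Dy eqy] : exists2 y, D i y & a ^+ n *: y = a ^+ n *: x.
      by apply: divD; rewrite eqn; exists x.
    exists y => //; exists (x - y); last by rewrite addrC subrK.
    split; first by apply: smemB => //; apply: DN.
    by rewrite scalerBr eqy subrr.
  apply/fg_iso2; have fgNn := fgXan n (N i) (NX i).
  by apply: (fg_top fgNn); [apply: szero_le|apply: smeet_r].
pose P W := exists i, W = colon (szero Q) (D i) a.
have [_ [n ->] maxW] : exists2 W, P W & forall W', P W' -> W <=s W' -> W' = W.
  apply: (acc_max0 A_noetherian (Z := colon (szero Q) (D 0%N) a) fgXa).
    by exists 0%N.
  by move=> _ [i ->] x [/DN /NX Xx ax].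
have eqDn i : (n <= i)%N -> colon (szero Q) (D i) a = colon (szero Q) (D n) a.
  move=> le_ni; apply: maxW; first by exists i.
  by move=> x [Dx ax]; split=> //; apply: (homo_sle leD le_ni).
exists n => i le_ni; suff eqD : D i.+1 <=s D i.
  apply: (fg_top (fgDN i.+1)) => //.
  by apply: sle_trans eqD (DN i).
(* Induction on the order of torsion: divisibility reduces the claim to the [a]-socles, which agree
   from [n] on. *)
move=> x Dx; have [k] := tors x (NX i.+1 x (DN i.+1 x Dx)).
elim: k x Dx => [|k IH] x Dx; first by rewrite scale1r => ->; apply: smem0.
rewrite exprSr -scalerA => /(IH _ (smemZ a Dx)) Dax.
have [y Dy] := divD i 1%N _ Dax; rewrite expr1 => eq_ay.
rewrite -(subrK y x); apply: smemD => //.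
have : colon (szero Q) (D i.+1) a (x - y).
  split; first by apply: smemB => //; apply: leD.
  by rewrite scalerBr eq_ay subrr.
by rewrite (eqDn i.+1) ?(leqW le_ni) // -(eqDn i) // => -[].
Qed.

Lemma colon_le X Y a : X <=s Y -> X <=s colon X Y a.
Proof. by move=> XY x Xx; split; [apply: XY|apply: smemZ]. Qed.

(** Multiplication by [a] makes P / X an extension of a(P / X) by its kernel. *)
Lemma fg_colon_ext X P a : X <=s P -> fg X (colon X P a) ->
  fg X (sjoin X (sub_img (scale_map Q a) P)) -> fg X P.
Proof.
move=> XP fgc fgj; apply: (fg_trans fgc).
have [t tP le_t] := fg_gens fgj (@sle_refl _ _ _).
have [u uP def_t] : exists2 u, (forall x, x \in u -> P x) & t = map (fun x => a *: x) u.
  elim: t tP {le_t} => [|y t IH] tP; first by exists [::].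
  have [|u uP ->] := IH; first by move=> x xt; apply: tP; rewrite inE xt orbT.
  have [x Px ->] := tP y (mem_head _ _); exists (x :: u) => // z.
  by rewrite inE => /predU1P[->|/uP].
exists u; apply: sle_anti; last by apply: adj_min => // x [].
move=> x Px; have: adj X t (a *: x) by apply: le_t; apply: sjoin_r; exists x.
rewrite def_t; elim: u uP x Px {def_t} => [|y u IH] uP x Px /=; first by split.
move=> [r Xr]; exists r; apply: IH.
- by move=> z zu; apply: uP; rewrite inE zu orbT.
- by apply: smemB => //; apply: smemZ; apply: uP; apply: mem_head.
- suff -> : a *: (x - r *: y) = a *: x - r *: (a *: y) by [].
  module_ring.
Qed.

Definition kill_ideal X P : submodule A^o.
Proof.
apply: (@sub_mk _ A^o [set a : A | forall x, P x -> X (a *: x)]) => /=.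
  by move=> x _; rewrite scale0r; apply: smem0.
move=> a r t Xr Xt x Px.
have lin (b c : A) : (a * b + c) *: x = a *: (b *: x) + c *: x by module_ring.
by have:= smem_lin a (Xr x Px) (Xt x Px); rewrite -lin; apply.
Defined.

(* The primes are the annihilators of the minimal non-finitely generated factors
   of [Y] over [X]. *)
Lemma thin_good_primes (m : submodule A^o) Y X :
  (forall a, ~ m a -> exists s : A, m (1 - s * a)) -> thin Y -> X <=s Y ->
  exists ps : seq (submodule A^o),
    (forall q, q \in ps -> prime_ideal q /\ ~ m <=s q) /\
    (forall b, (forall q, q \in ps -> ~ q b) -> fg X (colon X Y b)).
Proof.
move=> mmax thY; set R := (R in _ -> R) => XY; apply: contrapT => nR.
pose Rf X := exists ps : seq (submodule A^o),
    (forall q, q \in ps -> prime_ideal q /\ ~ m <=s q) /\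
    (forall b, (forall q, q \in ps -> ~ q b) -> fg X (colon X Y b)).
(* A counterexample has another one above it, over which it is not cofinitely generated; iteration
   contradicts thinness of [Y]. *)
have step X' : X' <=s Y -> ~ Rf X' ->
    exists P, [/\ X' <=s P, P <=s Y, ~ fg X' P & ~ Rf P].
  move=> {X R XY nR}; move: X' => X XY nR.
  have nfgY : ~ fg X Y.
    move=> fgY; apply: nR; exists [::]; split=> // b _.
    by apply: (fg_sub A_noetherian fgY); [apply: colon_le|move=> x []].
  have [P [XP PY nfgP] minP] := dcc_min
    (P := fun P => [/\ X <=s P, P <=s Y & ~ fg X P]) (Z := Y) art
    (And3 XY (@sle_refl _ _ Y) nfgY).
  have subP Z : X <=s Z -> Z <=s P -> ~ P <=s Z -> fg X Z.
    move=> XZ ZP nPZ; apply: contrapT => nfgZ; apply: nPZ.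
    rewrite (minP Z) //; split=> //; exact: sle_trans ZP PY.
  have colonP c : ~ kill_ideal X P c -> fg X (colon X P c).
    move=> ncP; apply: subP; [exact: colon_le|by move=> x []|move=> Ple].
    by apply: ncP => x /Ple[].
  exists P; split=> // -[ps [psP good]]; apply: nR.
  exists (kill_ideal X P :: ps); split=> [q|b bP].
    rewrite inE => /predU1P[->|/psP //]; split; [split|].
    - move=> k1; apply: nfgP; rewrite (_ : P = X); first exact: fg_refl.
      by apply: sle_anti => // x /k1; rewrite scale1r.
    - move=> c d cdP; have [dP|ndP] := pselect (kill_ideal X P d); first by right.
      left=> x Px.
      (* By minimality of [P], an element that does not kill P / X is surjective on it. *)
      have Ple : P <=s sjoin X (sub_img (scale_map Q d) P).
        apply: contrapT => nPle; apply: nfgP.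
        apply: (fg_colon_ext (a := d)) => //; first exact: colonP.
        apply: subP => //; first exact: sjoin_l.
        by apply: sjoin_le => // _ [y Py ->]; apply: smemZ.
      have [y Xy [_ [z Pz ->] ->]] := Ple x Px.
      rewrite scalerDr; apply: smemD; first exact: smemZ.
      by rewrite /= scalerA; apply: cdP.
    - move=> mP; apply: nfgP.
      by apply: (@residue_module_fg A Q X P m art) => // c y /mP; apply.
  have [nkb nqb] : ~ kill_ideal X P b /\ forall q, q \in ps -> ~ q b.
    by split=> [|q q_ps]; apply: bP; rewrite inE ?eqxx // q_ps orbT.
  apply: (fg_ext (U := P)); first exact: colon_le.
    rewrite (smeet_idl XP); apply: subP.
    - by move=> x Xx; split; [apply: (@colon_le X Y b XY)|apply: XP].
    - exact: smeet_r.
    - by move=> Ple; apply: nkb => x /Ple[[]].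
  rewrite (sjoin_idl XP); apply: (fg_sub A_noetherian (good b nqb)).
    exact: sjoin_r.
  apply: sjoin_le; last exact: colon_le.
  by move=> x [Yx Xbx]; split=> //; apply: XP.
pose T := {P | P <=s Y /\ ~ Rf P}.
have next (t : T) : {t' : T | sval t <=s sval t' /\ ~ fg (sval t) (sval t')}.
  apply: cid; case: t => P [PY nRP].
  have [P' [PP' P'Y nfg nRP']] := step P PY nRP.
  by exists (exist _ P' (conj P'Y nRP')).
have [f [_ fP]] := dependent_choice next (exist _ X (conj XY nR) : T).
have [||n nP] := thY (fun i => sval (f i)).
- by move=> i; case: (fP i).
- by move=> i; case: (svalP (f i)).
by have [_] := fP n; apply; apply: nP.
Qed.

Lemma perturb_stable a b (S : set nat) n k (z : Q) :
  b ^+ n *: z = 0 -> (a - b * series S b n) *: z = 0 -> (n <= k)%N ->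
  (a - b * series S b k) *: z = 0.
Proof.
move=> bz az le_nk; rewrite -(subnKC le_nk) scalerBl -scalerA series_stable //.
by rewrite scalerA -scalerBl.
Qed.

(* The kernel in [X] of [a - \sum_(i in S) b^(i+1)], an operator that makes sense
   because [b] is locally nilpotent on [X]. *)
Definition perturbed (X : submodule Q) (a b : A) (S : set nat) : submodule Q.
Proof.
apply: (@sub_mk _ _ [set x : Q | X x /\ exists n,
  b ^+ n *: x = 0 /\ (a - b * series S b n) *: x = 0]) => /=.
  split; first exact: smem0.
  by exists 0%N; rewrite !scaler0.
move=> r x y [Xx [i [bx ax]]] [Xy [j [by_ ay]]]; split; first exact: smem_lin.
exists (i + j)%N; split.
  by rewrite scalerDr scalerA mulrC -scalerA expr_stable // scaler0 add0r addnC expr_stable.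
rewrite scalerDr scalerA mulrC -scalerA.
rewrite (perturb_stable bx ax) ?leq_addr // (perturb_stable by_ ay) ?leq_addl //.
by rewrite scaler0 addr0.
Defined.

(** Where the sets first differ, the series differ by b^k, and all later terms are multiples of
    b^(k+1). *)
Lemma series_diff (S S' : set nat) b k j :
  (forall i, (i < k)%N -> S i = S' i) -> S k -> ~ S' k ->
  exists r, series S b (k.+1 + j) = series S' b (k.+1 + j) + b ^+ k * (1 + b * r).
Proof.
move=> eqS Sk S'k; elim: j => [|j [r IH]].
  exists 0; rewrite addn0 /series !big_ord_recr /=.
  rewrite (asboolT Sk) (asboolF S'k) mulr0 !addr0 mulr1; congr (_ + _).
  by apply: eq_bigr => i _; rewrite eqS.
have seriesS (T : set nat) n : series T b n.+1 =
    series T b n + (if `[< T n >] then b ^+ n else 0) by exact: big_ord_recr.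
rewrite addnS (seriesS S) (seriesS S') IH.
exists (r + b ^+ j * ((if `[< S (k.+1 + j)%N >] then 1 else 0) -
                      (if `[< S' (k.+1 + j)%N >] then 1 else 0))).
by case: asboolP => _; case: asboolP => _; rewrite ?exprD ?exprS; ring.
Qed.

Lemma unit_perturb (b r : A) n (w : Q) :
  b ^+ n *: w = 0 -> (1 + b * r) *: w = 0 -> w = 0.
Proof.
elim: n => [|n IH]; first by rewrite scale1r.
move=> bw rw; apply: IH => //.
have -> : b ^+ n *: w = b ^+ n *: ((1 + b * r) *: w) - r *: (b ^+ n.+1 *: w).
  by rewrite exprS; module_ring.
by rewrite rw bw !scaler0 subrr.
Qed.

(** If [k] is the first difference of two sets with the same kernel, this kernel is killed by
    b^(k+1). Then X[c], for a truncated operator c, is finitely generated and [thin_colon] makes [X]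
    thin. *)
Lemma perturbed_inj (m : submodule A^o) X a b :
  ~ thin X -> (forall c x, m c -> X x -> exists n, c ^+ n *: x = 0) ->
  m a -> m b -> fg (szero Q) (colon (szero Q) (colon (szero Q) X a) b) ->
  injective (perturbed X a b).
Proof.
move=> nthX tors ma mb fgab.
have sym S S' k : perturbed X a b S = perturbed X a b S' ->
    (forall i, (i < k)%N -> S i = S' i) -> S k -> S' k.
  move=> eqP eqS Sk; apply: contrapT => nS'k.
  have killed x : perturbed X a b S x -> b ^+ k.+1 *: x = 0.
    move=> PSx; have := PSx; rewrite eqP => -[_ [n' [bx' ax']]].
    case: PSx => Xx [n [bx ax]].
    have [r diff] := series_diff b (n + n') eqS Sk nS'k.
    set l := (k.+1 + (n + n'))%N in diff.
    have le_nl : (n <= l)%N by rewrite /l addnCA leq_addr.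
    have le_n'l : (n' <= l)%N by rewrite /l addnA leq_addl.
    apply: (@unit_perturb b r n); first by rewrite scalerA mulrC -scalerA bx scaler0.
    have -> : (1 + b * r) *: (b ^+ k.+1 *: x) =
        (a - b * series S' b l) *: x - (a - b * series S b l) *: x.
      by rewrite diff exprS; module_ring.
    by rewrite (perturb_stable bx ax) // (perturb_stable bx' ax') // subrr.
  (* Truncation at k+2, one above the exponent just found: the induction below first proves b^(k+2)
     x = 0, which puts [x] in the perturbed kernel. *)
  apply: nthX; pose c := a - b * series S b k.+2.
  have mc : m c.
    by apply: (@smemB A A^o) => //; rewrite mulrC; apply: ideal_mul.
  apply: (thin_colon (a := c)) => [x Xx|]; first exact: tors.
  (* [c] and [a] agree on elements killed by [b], so X[c, b] lies in X[a, b]; powers of [b] follow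
     by extension. *)
  have fgZ j : fg (szero Q) (colon (szero Q) (colon (szero Q) X c) (b ^+ j)).
    elim: j => [|j IH].
      rewrite (_ : colon _ _ _ = szero Q); first exact: fg_refl.
      apply: sle_anti; last exact: szero_le.
      by move=> x [_]; rewrite scale1r.
    apply: (fg_colon_ext (a := b)); first exact: szero_le.
      apply: fg0_sub fgab _ => x [[[Xx cx] _] bx]; split=> //; split=> //.
      have -> : a *: x = c *: x + series S b k.+2 *: (b *: x).
        by rewrite /c; module_ring.
      have -> : c *: x = 0 by exact: cx.
      have -> : b *: x = 0 by exact: bx.
      by rewrite scaler0 addr0.
    apply: fg0_sub IH _; apply: sjoin_le; first exact: szero_le.
    move=> _ [x [[Xx cx] bx] ->]; split; last first.
      have -> : b ^+ j *: scale_map Q b x = b ^+ j.+1 *: x.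
        by rewrite exprSr -scalerA.
      exact: bx.
    split; first exact: smemZ.
    rewrite /= scalerA mulrC -scalerA; have -> : c *: x = 0 by exact: cx.
    by rewrite scaler0.
  apply: fg0_sub (fgZ k.+1) _ => x [Xx cx]; split=> //.
  have [n bx] := tors b x mb Xx; have [le_nk|/ltnW lt_kn] := leqP n k.+1.
    by rewrite -(subnKC le_nk); apply: expr_stable.
  move: bx; rewrite -(subnKC lt_kn); elim: (n - k.+1)%N x Xx cx => [|j IH] x Xx cx.
    by rewrite addn0.
  rewrite addnS exprSr -scalerA => bx; apply: killed; split=> //; exists k.+2.
  split; last exact: cx.
  rewrite exprSr -scalerA; apply: IH => //; first exact: smemZ.
  change (c *: (b *: x) = 0); rewrite scalerA mulrC -scalerA.
  have -> : c *: x = 0 by exact: cx.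
  by rewrite scaler0.
move=> S S' eqP; apply/funext => k; elim/ltn_ind: k => k IH.
by apply/propext; split; apply: sym => // i /IH.
Qed.

(** X[a] is thin by minimality of [X], so finitely many primes control when X[a, b] is finitely
    generated; [b] is chosen in [m] outside them. *)
Lemma continuum_not_thin : ~ thin (sfull Q) -> continuum_submodules Q.
Proof.
move=> nthQ.
have [X [m [nthX smallX mmax tors [a [x [ma Xx nax]]]]]] :=
  devissage art thin_fg thinD nthQ.
have thXa : thin (colon (szero Q) X a).
  by apply: smallX => [y []//|Xle]; apply: nax; case: (Xle x Xx).
have [ps [psP good]] := thin_good_primes mmax thXa (@szero_le _).
have [b mb bP] := prime_avoidance psP.
exists (perturbed X a b); apply: (perturbed_inj nthX tors ma mb).
exact: good.
Qed.

End Thin.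

(** * Countability *)

Section Countable.

Lemma countable_sub (T : Type) (S S' : set T) :
  (forall x, S x -> S' x) -> countable S' -> countable S.
Proof. by move=> SS'; apply: sub_countable; apply: subset_card_le. Qed.

Lemma countable_fibers (T I : Type) (S : set T) (D : set I) (f : T -> I) :
  countable D -> (forall x, S x -> D (f x)) ->
  (forall i, D i -> countable [set x | S x /\ f x = i]%classic) -> countable S.
Proof.
move=> cD SD cf; apply: countable_sub (bigcup_countable cD cf) => x Sx.
by exists (f x); [apply: SD|].
Qed.

Lemma countable_image2 (T1 T2 T : Type) (S1 : set T1) (S2 : set T2)
    (f : T1 -> T2 -> T) (S : set T) : countable S1 -> countable S2 ->
  (forall x, S x -> exists2 y, S1 y & exists2 z, S2 z & x = f y z) ->
  countable S.
Proof.
move=> c1 c2 SP.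
apply: (countable_sub (S' := \bigcup_(y in S1) \bigcup_(z in S2) [set f y z])%classic).
  by move=> x /SP[y S1y [z S2z ->]]; exists y => //; exists z.
apply: bigcup_countable => // y _; apply: bigcup_countable => // z _.
Qed.

Lemma countable_seq (T : Type) : countable [set: T] -> countable [set: seq T].
Proof.
move=> /countable_injP[f f_inj]; apply/countable_injP.
exists (pickle \o map f) => s t _ _ /= /(pcan_inj pickleK).
by apply: inj_map => x y; apply: f_inj; rewrite in_setT.
Qed.

End Countable.

Section CountableModules.
Variable A : comPzRingType.
Variable A_countable : countable [set: A].

Definition csub (M : lmodType A) (X : submodule M) := countable [set x | X x]%classic.

Lemma csub_fg (M : lmodType A) (X : submodule M) : fg (szero M) X -> csub X.
Proof.
move=> [s ->]; elim: s => [|x s IH] /=.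
  by apply: countable_sub (countable1 (0 : M)).
apply: (countable_image2 (f := fun y a => y + a *: x) IH A_countable).
move=> y [a ay]; exists (y - a *: x) => //; exists a => //.
by rewrite subrK.
Qed.

(** In a minimal uncountable submodule [X], the kernel of [a] is countable, hence so is each X[a^n],
    and [X] is their union. *)
Lemma artinian_countable (Q : lmodType A) :
  module_artinian Q -> countable [set: Q].
Proof.
move=> art; suff: csub (sfull Q) by apply: countable_sub.
apply: contrapT => nc.
have csubD (X Y : submodule Q) : csub X -> csub Y -> csub (sjoin X Y).
  move=> cX cY; apply: (countable_image2 (f := fun x y => x + y) cX cY).
  by move=> z [x Xx [y Yy ->]]; exists x => //; exists y.
have [X [m [ncX smallX _ tors [a [x1 [ma Xx1 ax1]]]]]] :=
  devissage art (@csub_fg Q) csubD nc.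
apply: ncX.
have cXn n : csub (colon (szero Q) X (a ^+ n)).
  elim: n => [|n IH].
    apply: countable_sub (countable1 (0 : Q)) => x [_].
    by rewrite scale1r.
  apply: (countable_fibers (f := fun x => a *: x) IH) => [x [Xx ax]|y [Xy _]].
    split; first exact: smemZ.
    by change (a ^+ n *: (a *: x) = 0); rewrite scalerA -exprSr.
  have [[x0 [Xx0 ax0]]|nx0] := pselect (exists x0, X x0 /\ a *: x0 = y); last first.
    apply: (countable_sub (S' := set0)) => [x [[Xx _] ax]|]; last exact: countable0.
    by case: nx0; exists x.
  have cXa : csub (colon (szero Q) X a).
    apply: smallX => [x []//|Xle]; apply: ax1.
    by have [_] := Xle x1 Xx1.
  apply: (countable_image2 (f := fun z u => z + u) cXa (countable1 x0)).
  move=> x [[Xx _] ax]; exists (x - x0); last by exists x0; rewrite // subrK.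
  split; first exact: smemB.
  by change (a *: (x - x0) = 0); rewrite scalerBr ax ax0 subrr.
apply: (countable_sub (S' := \bigcup_(n in [set: nat])
    [set x | colon (szero Q) X (a ^+ n) x])%classic).
  by move=> x Xx; have [n ax] := tors a x ma Xx; exists n.
by apply: bigcup_countable => [|n _]; [exact: countableP|exact: cXn].
Qed.

End CountableModules.

(** * Submodules as modules, and subquotients *)

Section SubquotientModules.
Variable A : comPzRingType.

Lemma artinian_quotient (M Q : lmodType A) (p : {linear M -> Q}) :
  quotient_map p -> module_artinian M -> module_artinian Q.
Proof.
move=> p_surj art N leN.
have [|n eqN] := artinian_dcc (N := fun i => sub_pre p (N i)) art.
  by move=> i x; apply: leN.
exists n => m /eqN; exact: (sub_pre_inj p_surj).
Qed.

Lemma val_linear (M : lmodType A) (N : submodule M) :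
  linear (val : submodule_sort N -> M).
Proof. by move=> a u v; rewrite linearP. Qed.

Definition val_map (M : lmodType A) (N : submodule M)
  : {linear submodule_sort N -> M} := mk_linear (@val_linear M N).

Lemma sub_img_val_inj (M : lmodType A) (N : submodule M) :
  injective (sub_img (val_map N)).
Proof.
have le W W' : sub_img (val_map N) W = sub_img (val_map N) W' -> W <=s W'.
  move=> eqW u Wu; have: sub_img (val_map N) W (val u) by exists u.
  by rewrite eqW => -[u' W'u' /val_inj->].
by move=> W W' eqW; apply: sle_anti; apply: le.
Qed.

Lemma val_smem (M : lmodType A) (N : submodule M) (u : submodule_sort N) : N (val u).
Proof. by have := valP u; rewrite inE. Qed.

Definition to_sort (M : lmodType A) (N : submodule M) x (Nx : N x)
  : submodule_sort N := exist _ x (mem_set Nx).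

Lemma artinian_sort (M : lmodType A) (N : submodule M) :
  module_artinian M -> module_artinian (submodule_sort N).
Proof.
move=> art W leW.
have [|n eqN] := artinian_dcc (N := fun i => sub_img (val_map N) (W i)) art.
  by move=> i; apply: sub_img_mono; apply: leW.
by exists n => m /eqN; apply: sub_img_val_inj.
Qed.

Lemma noetherian_sort_fg (M : lmodType A) (N : submodule M) :
  module_noetherian (submodule_sort N) -> fg (szero M) N.
Proof.
move=> noeth; apply: acc_fg => [W leW WN|_ ->]; last exact: smem0.
have [i|n eqW] := noeth (fun i => sub_pre (val_map N) (W i)).
  by move=> u; apply: leW.
exists n; apply: sle_anti; last exact: leW.
move=> x Wx; have Nx := (WN _).2 x Wx.
have: sub_pre (val_map N) (W n.+1) (to_sort Nx) by [].
by rewrite eqW.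
Qed.

Lemma not_fg_infinite_length (M : lmodType A) (N : submodule M) :
  ~ fg (szero M) N -> ~ module_finite_length (submodule_sort N).
Proof.
move=> /not_fg_seq[|x xP [l lP]]; first by move=> _ ->; apply: smem0.
have /lP : forall i, (i < l.+1)%N ->
    (sub_pre (val_map N) (adjn (szero M) x i) `<`
     sub_pre (val_map N) (adjn (szero M) x i.+1))%classic.
  move=> i _; split.
    by move=> u; apply: adj1_le.
  have [Nx nx] := xP i => /(_ (to_sort Nx)) le_x; apply: nx.
  by apply: le_x; apply: adj1_mem.
by rewrite ltnn.
Qed.

Lemma iso_to_subquotient_quotient (M Q P : lmodType A) (p : {linear M -> Q}) :
  quotient_map p -> iso_to_subquotient P Q -> iso_to_subquotient P M.
Proof.
move=> p_surj [N [q q_surj]]; exists (sub_pre p N).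
pose f (u : submodule_sort (sub_pre p N)) : submodule_sort N :=
  to_sort (val_smem u : N (p (val u))).
have f_lin : linear f.
  by move=> a u v; apply: val_inj; rewrite linearP /= !linearP.
exists (mk_linear (linearP (q \o mk_linear f_lin))) => y.
have [u <-] := q_surj y; have [x def_x] := p_surj (val u).
have Nx : sub_pre p N x.
  by change (N (p x)); rewrite def_x; apply: val_smem.
exists (to_sort Nx); rewrite /=; congr (q _); exact: val_inj.
Qed.

(* [x + y |-> (x, y)] is well defined modulo [P1 /\ P2]. *)
Lemma square_subquotient (M Q : lmodType A) (p : {linear M -> Q})
    (P1 P2 : submodule M) :
  smeet P1 P2 <=s sub_ker p -> sub_img p P1 = sub_img p P2 ->
  iso_to_subquotient
    (submodule_sort (sub_img p P1) * submodule_sort (sub_img p P1))%type M.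
Proof.
move=> P12p eqp; set V := sub_img p P1 in eqp *.
have V2 y : P2 y -> V (p y) by rewrite eqp; apply: sub_img_mem.
exists (sjoin P1 P2).
have dec (u : submodule_sort (sjoin P1 P2)) : {x | P1 x /\ P2 (val u - x)}.
  apply: cid; have [x P1x [y P2y def_u]] := val_smem u.
  by exists x; rewrite def_u (addrC x) addrK.
pose g u := sval (dec u).
have g1 u : P1 (g u) by case: (svalP (dec u)).
have g2 u : P2 (val u - g u) by case: (svalP (dec u)).
have g_eq u x : P1 x -> P2 (val u - x) -> p (g u) = p x.
  move=> P1x P2x; apply/eqP; rewrite -subr_eq0 -linearB; apply/eqP; apply: P12p.
  split; first exact: smemB.
  by rewrite -[g u - x](subrKA (val u)) -opprB addrC; apply: smemB.
pose f u : (submodule_sort V * submodule_sort V)%type :=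
  (to_sort (sub_img_mem p (g1 u)), to_sort (V2 _ (g2 u))).
have f_lin : linear f.
  move=> a u v; have eq_g : p (g (a *: u + v)) = a *: p (g u) + p (g v).
    rewrite -linearP; apply: g_eq; first exact: smem_lin.
    have -> : val (a *: u + v) - (a *: g u + g v) =
        a *: (val u - g u) + (val v - g v) by rewrite linearP /=; module_ring.
    exact: smem_lin.
  congr (_, _); apply: val_inj; first exact: eq_g.
  change (p (val (a *: u + v) - g (a *: u + v)) =
          a *: p (val u - g u) + p (val v - g v)).
  have -> : p (val (a *: u + v) - g (a *: u + v)) =
      p (a *: val u + val v) - p (g (a *: u + v)) by exact: linearB.
  have -> : p (a *: val u + val v) = a *: p (val u) + p (val v) by exact: linearP.
  have pB x y : p (x - y) = p x - p y by exact: linearB.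
  by rewrite eq_g !pB; module_ring.
exists (mk_linear f_lin) => -[s t].
have [x P1x def_s] := val_smem s.
have [y P2y def_t] : sub_img p P2 (val t) by rewrite -eqp; apply: val_smem.
have Nxy : sjoin P1 P2 (x + y) by exists x => //; exists y.
exists (to_sort Nxy).
have eq_g : p (g (to_sort Nxy)) = p x by apply: g_eq; rewrite //= addrC addKr.
congr (_, _); apply: val_inj => /=; first by rewrite eq_g.
by rewrite linearB linearD /= eq_g addrC addKr.
Qed.

End SubquotientModules.

(** * Counting the submodules of a thin artinian module *)

Section CountingArtinian.
Variables (A : comPzRingType) (A_noetherian : ring_noetherian A).
Variables (Q : lmodType A) (art : module_artinian Q).
Hypotheses (thinQ : thin (sfull Q)) (sqfreeQ : property_L11 Q).
Implicit Types (X Y Z P D H : submodule Q).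

(* Minimal nonzero submodules over [X] modulo finitely generated ones. *)
Definition min_inf X P :=
  [/\ X <=s P, ~ fg X P & forall P', X <=s P' -> P' <=s P -> ~ P <=s P' -> fg X P'].

(** A proper trace of [Z] on [P] is finitely generated over [X], and [P] would then be so too. *)
Lemma min_inf_dichotomy X P Z : min_inf X P -> X <=s Z ->
  fg (smeet Z P) P -> P <=s Z.
Proof.
move=> [XP nfg minP] XZ fgZP; apply: contrapT => nPZ; apply: nfg.
apply: (fg_trans _ fgZP); apply: minP => [x Xx||Ple].
- by split; [apply: XZ|apply: XP].
- exact: smeet_r.
- by apply: nPZ => x /Ple[].
Qed.

Lemma min_inf_eq X P1 P2 : min_inf X P1 -> min_inf X P2 -> P1 <=s P2 -> P1 = P2.
Proof.
move=> [XP1 nfg1 _] [_ _ min2] P12; apply: sle_anti => //.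
by apply: contrapT => nP21; apply: nfg1; apply: min2.
Qed.

(** Exchange property: otherwise V = P2 /\ (Z + P1) is finitely generated over [X], and Z + P1 = Z +
    V by modularity, so that [P1] is contained in [Z]. *)
Lemma min_inf_join X Z P1 P2 : min_inf X P1 -> min_inf X P2 -> X <=s Z ->
  ~ P1 <=s Z -> P1 <=s sjoin Z P2 -> P2 <=s sjoin Z P1.
Proof.
move=> m1 m2 XZ nP1Z P1le; have [XP2 nfg2 min2] := m2.
apply: contrapT => nP2; apply: nP1Z; apply: (min_inf_dichotomy m1 XZ).
apply/fg_iso2; set V := smeet P2 (sjoin Z P1).
have fgXV : fg X V.
  apply: min2; last by move=> P2V; apply: nP2 => x /P2V[].
    by move=> x Xx; split; [apply: XP2|apply/sjoin_l/XZ].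
  exact: smeet_l.
have -> : sjoin Z P1 = sjoin V Z.
  rewrite [RHS]sjoinC -smodular; last exact: sjoin_l.
  rewrite smeetC smeet_idl //; apply: sjoin_le => //; exact: sjoin_l.
by rewrite -{1}(sjoin_idl XZ); apply: fg_add.
Qed.

(* Otherwise [(P1 + Z) / ((P1 /\ P2) + Z)] would have its square as a
   subquotient. *)
Lemma min_inf_independent X Z P1 P2 : min_inf X P1 -> min_inf X P2 -> X <=s Z ->
  P1 <> P2 -> ~ P1 <=s Z -> ~ P1 <=s sjoin Z P2.
Proof.
move=> m1 m2 XZ ne12 nP1Z P1le.
have P2le := min_inf_join m1 m2 XZ nP1Z P1le.
have [XP1 nfg1 min1] := m1; have [XP2 nfg2 min2] := m2.
set F := smeet P1 P2.
have fgXF : fg X F.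
  apply: min1; [by move=> x Xx; split; auto|exact: smeet_l|].
  by move=> P1F; apply: ne12; apply: (min_inf_eq m1 m2) => x /P1F[].
pose W := sjoin F Z; have [G [p [p_surj kerW]]] := quotient_exists W.
have pW x : W x -> p x = 0 by rewrite -kerW.
have eq_img : sub_img p P1 = sub_img p P2.
  have le P P' : P <=s sjoin Z P' -> sub_img p P <=s sub_img p P'.
    move=> Ple _ [x /Ple[z Zz [y P'y ->]] ->]; exists y => //.
    by rewrite linearD pW ?add0r //; apply: sjoin_r.
  by apply: sle_anti; apply: le.
have /sqfreeQ nsq : module_artinian (submodule_sort (sub_img p P1)).
  by apply: artinian_sort; apply: artinian_quotient art.
apply: (nsq (not_fg_infinite_length _)); last first.
  by apply: (square_subquotient (P2 := P2)) => // x Fx; rewrite kerW; apply: sjoin_l.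
(* The common image has infinite length: if it were finitely generated, so would be (P1 + Z) / Z,
   because W / Z is. *)
move=> fgV; apply: nP1Z; apply: (min_inf_dichotomy m1 XZ).
have WP1 : W <=s sjoin W P1 by apply: sjoin_l.
have fgW : fg W (sjoin W P1).
  have /(fg_img_inv WP1) : fg (sub_img p W) (sub_img p (sjoin W P1)).
    have -> : sub_img p W = szero _.
      apply: sub_ext => y; split=> [[x /pW px ->]//|->].
      by exists 0; [exact: smem0|rewrite linear0].
    have -> : sub_img p (sjoin W P1) = sub_img p P1; last by [].
    apply: sle_anti; last by apply: sub_img_mono; apply: sjoin_r.
    move=> _ [x [w Ww [y P1y ->]] ->]; exists y => //.
    by rewrite linearD pW ?add0r.
  rewrite kerW; have -> : sjoin W W = W by apply: sjoin_idl.
  by have -> : sjoin (sjoin W P1) W = sjoin W P1 by rewrite sjoinC; apply: sjoin_idl.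
apply/fg_iso2; apply: (fg_sub A_noetherian (Y := sjoin W P1)).
- apply: fg_trans fgW.
  by rewrite -{1}(sjoin_idl XZ); apply: fg_add.
- exact: sjoin_l.
- apply: sjoin_le; last exact: sjoin_r.
  by move=> z Zz; apply: sjoin_l; apply: sjoin_r.
Qed.

(** The family is even finite: summing an infinite sequence of distinct members, thinness puts some
    [f k] in an earlier sum. *)
Lemma min_inf_countable X : countable [set P | min_inf X P]%classic.
Proof.
apply: contrapT => nc.
have [f fP f_inj] : exists2 f : nat -> submodule Q,
    (forall i, min_inf X (f i)) & injective f.
  have /infiniteP/card_leP[f] : infinite_set [set P | min_inf X P]%classic.
    by move=> /finite_set_countable.
  exists (fun i => val (f (to_setT i))) => [i|i j /val_inj eq_f].
    by have := valP (f (to_setT i)); rewrite inE.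
  have : to_setT i = to_setT j by apply: (@inj _ _ _ f) eq_f; rewrite inE.
  by move/(congr1 val).
pose Z := fix Z n := if n is n'.+1 then sjoin (Z n') (f n') else X.
have leZ i : Z i <=s Z i.+1 by apply: sjoin_l.
have XZ i : X <=s Z i by apply: (homo_sle leZ (leq0n i)).
have [||k kP] := thinQ (N := Z) => //.
have fk : f k <=s Z k.
  by apply: (min_inf_dichotomy (fP k)) => //; apply/fg_iso2; apply: kP.
have exj : exists j, `[< f k <=s Z j >] by exists k; apply/asboolP.
(* At the least such sum, [f k] lies in Z_j + f_j but not in Z_j, against independence. *)
have /asboolP := ex_minnP exj; case: ex_minnP => -[|j] /asboolP fkZ minj _.
  case: (fP k) => Xf nfg _; apply: nfg.
  by rewrite (sle_anti fkZ Xf); apply: fg_refl.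
have lt_jk : (j < k)%N by apply: minj; apply/asboolP.
apply: (min_inf_independent (fP k) (fP j) (XZ j)) fkZ.
  by move/f_inj => eq_kj; rewrite eq_kj ltnn in lt_jk.
by move=> fkj; have := minj j (introT (asboolP _) fkj); rewrite ltnn.
Qed.

(** Connectedness over [X]: D / X has no nonzero finitely generated quotient. *)
Definition conn X D :=
  X <=s D /\ forall D', X <=s D' -> D' <=s D -> fg D' D -> D <=s D'.

(** Induction along the steps that are not finitely generated, well founded by thinness: a connected
    [D] other than [X] contains a minimal [P] over [X] and is connected over it. *)
Lemma conn_countable X : countable [set D | conn X D]%classic.
Proof.
apply: contrapT => ncX.
pose T := {X | ~ countable [set D | conn X D]%classic}.
have next (t : T) : {t' : T | sval t <=s sval t' /\ ~ fg (sval t) (sval t')}.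
  apply: cid; case: t => {ncX}X ncX /=; apply: contrapT => nt; apply: ncX.
  have cP P : min_inf X P -> countable [set D | conn P D]%classic.
    move=> [XP nfg _]; apply: contrapT => ncP; apply: nt.
    by exists (exist _ P ncP).
  apply: (countable_sub
    (S' := (\bigcup_(b in [set: bool]) (if b then [set X] else
              \bigcup_(P in [set P | min_inf X P]) [set D | conn P D]))%classic)).
    move=> D [XD connD]; have [DX|nDX] := pselect (D <=s X).
      by exists true => //; apply: sle_anti.
    have nfgD : ~ fg X D by move=> fgD; apply: nDX; apply: connD.
    have [P [XP PD nfgP] minP] := dcc_min
      (P := fun P => [/\ X <=s P, P <=s D & ~ fg X P]) (Z := D) art
      (And3 XD (@sle_refl _ _ D) nfgD).
    exists false => //; exists P; last first.
      by split=> // D' PD' D'D; apply: connD => //; apply: sle_trans PD'.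
    split=> // P' XP' P'P nPP'; apply: contrapT => nfgP'; apply: nPP'.
    by rewrite (minP P') //; split=> //; apply: sle_trans PD.
  apply: bigcup_countable => [|[] _]; [exact: countableP|exact: countable1|].
  by apply: bigcup_countable; [apply: min_inf_countable|apply: cP].
have [f [_ fP]] := dependent_choice next (exist _ X ncX : T).
have [||n nP] := thinQ (N := fun i => sval (f i)) => //.
  by move=> i; case: (fP i).
by have [_] := fP n; apply; apply: nP.
Qed.

Lemma artinian_sub_countable : countable [set: Q] -> countable [set: submodule Q].
Proof.
move=> cQ.
apply: (countable_image2 (f := fun D s => adj D s)
          (conn_countable (szero Q)) (countable_seq cQ)) => H _.
have [D fgD minD] := dcc_min (P := fun D => fg D H) art (fg_refl H).
exists D; last by have [s def_H] := fgD; exists s.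
split; first exact: szero_le.
by move=> D' _ D'D fgD'; rewrite (minD D') //; apply: fg_trans fgD.
Qed.

End CountingArtinian.

(** * Counting the submodules of a minimax module *)

Section CountingMinimax.
Variables (A : comPzRingType) (A_noetherian : ring_noetherian A).
Variables (M Q : lmodType A) (p : {linear M -> Q}) (K : submodule M).
Hypothesis kerK : sub_ker p = K.
Hypotheses (fgK : fg (szero M) K) (art : module_artinian Q).
Implicit Types H D : submodule M.

(** H' / (H /\ H') embeds into (H + K) / H, a quotient of [K]. *)
Lemma fg_meet_same_image H H' : sub_img p H = sub_img p H' -> fg (smeet H H') H'.
Proof.
move=> eq_img; apply/fg_iso2; apply: (fg_sub A_noetherian (Y := sjoin H K)).
- apply/fg_iso2; apply: (fg_top fgK); last exact: smeet_r.
  by move=> _ ->; apply: smem0.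
- exact: sjoin_l.
- by apply: sjoin_le; [apply: sjoin_l|rewrite -kerK -sub_pre_img eq_img => x; exists x].
Qed.

(* [D] is the smallest submodule between [H0 /\ K] and [H0] such that [H0 / D]
   is finitely generated. *)
Lemma fiber_base H0 : exists D, forall H, smeet H K = smeet H0 K ->
  sub_img p H = sub_img p H0 -> fg D H.
Proof.
(* Minimality is taken among images in [Q], where descending chains stop; since [D] contains the
   trace of [H0] on [K], its image determines it. *)
pose P V := exists D, [/\ smeet H0 K <=s D, D <=s H0, fg D H0 & V = sub_img p D].
have [_ [D [KD DH0 fgD ->]] minD] : exists2 V, P V &
    forall V', P V' -> V' <=s V -> V' = V.
  apply: (dcc_min (Z := sub_img p H0) art); exists H0; split=> //.
  - exact: smeet_l.
  - exact: fg_refl.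
exists D => H eqK eq_img; have fgHH0 := fg_meet_same_image eq_img.
have fgD2 : fg (smeet D H) H0.
  apply: fg_trans fgD; have := fg_meet A_noetherian D fgHH0.
  rewrite [smeet H0 D]smeetC (smeet_idl DH0).
  have -> // : smeet (smeet H H0) D = smeet D H.
  by apply: sub_ext => x; split=> [[[]]|[Dx Hx]] //; do 2?split=> //; apply: DH0.
have KD2 : smeet H0 K <=s smeet D H.
  by move=> x KHx; split; [apply: KD|move: KHx; rewrite -eqK => -[]].
have DH : D <=s H.
  move=> x Dx; have : sub_img p (smeet D H) (p x).
    rewrite (minD (sub_img p (smeet D H))); first by exists x.
      by exists (smeet D H); split=> // y [/DH0].
    by apply: sub_img_mono; apply: smeet_l.
  move=> [y [Dy Hy] eq_p]; rewrite -(subrK y x); apply: smemD => //.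
  have [] // : smeet D H (x - y); apply: KD2; split.
    by apply: smemB; apply: DH0.
  by rewrite -kerK; change (p (x - y) = 0); rewrite linearB /= eq_p subrr.
apply: (fg_trans (Y := smeet H0 H)); last by apply: fg_meet_same_image.
apply: (fg_sub A_noetherian fgD); last exact: smeet_l.
by move=> x Dx; split; [apply: DH0|apply: DH].
Qed.

Lemma minimax_sub_countable : countable [set: M] ->
  countable [set: submodule Q] -> countable [set: submodule M].
Proof.
move=> cM cQ; have cseq := countable_seq cM.
apply: (countable_fibers (f := fun H => smeet H K)
          (D := [set adj (szero M) s | s in [set: seq M]]%classic)).
- apply: (countable_image2 (f := fun s (_ : unit) => adj (szero M) s)
            cseq (countable1 tt)).
  by move=> _ [s _ <-]; exists s => //; exists tt.
- move=> H _; have [s def_H] : fg (szero M) (smeet H K).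
    apply: (fg_sub A_noetherian fgK); last exact: smeet_r.
    by move=> _ ->; apply: smem0.
  by exists s.
move=> KH _.
apply: (countable_fibers (f := sub_img p) cQ) => // V _.
set S := (S in countable S).
have [[H0 [[_ eqK0] eqV0]]|nS] := pselect (exists H0, S H0); last first.
  apply: (countable_sub (S' := set0)); last exact: countable0.
  by move=> H SH; case: nS; exists H.
have [D DP] := fiber_base H0.
apply: (countable_image2 (f := fun D s => adj D s) (countable1 D) cseq).
move=> H [[_ eqK] eqV]; exists D => //.
by have [||s def_H] := DP H; [rewrite eqK|rewrite eqV|exists s].
Qed.

End CountingMinimax.

(** * Thin modules and chains of type omega^2 *)

Section Omega2.
Variables (A : comPzRingType) (A_noetherian : ring_noetherian A) (M : lmodType A).

(** Some c(n+1, 0) would be finitely generated over c(n, 0), leaving no room for the strictly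
    increasing c(n, i) in between. *)
Lemma thin_no_omega2 : thin (sfull M) -> ~ has_omega2_chain M.
Proof.
move=> th [c cP].
have leP (a b : nat *l nat) : (a <= b)%O -> c a <=s c b by move/cP.
have [||n nP] := th (fun i => c (i, 0%N)) => //.
  by move=> i; apply: leP; rewrite Order.ProdLexiOrder.lexi_pair leEnat leqnSn ltnn.
pose P W := exists i, W = c (n, i).
have [_ [i ->] maxW] : exists2 W, P W & forall W', P W' -> W <=s W' -> W' = W.
  apply: (acc_max A_noetherian (nP n (leqnn n)) (Z := c (n, 0%N))); first by exists 0%N.
  move=> _ [i ->]; split; apply: leP;
    by rewrite Order.ProdLexiOrder.lexi_pair !leEnat ?leqnn ?leqnSn ?ltnn.
have /cP : (c (n, i.+1) `<=` c (n, i))%classic.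
  rewrite (maxW (c (n, i.+1))) //; first by exists i.+1.
  by apply: leP; rewrite Order.ProdLexiOrder.lexi_pair !leEnat leqnn /= leqnSn.
by rewrite Order.ProdLexiOrder.lexi_pair !leEnat leqnn /= ltnn.
Qed.

(** Each of infinitely many steps that are not finitely generated is filled with a chain of type
    omega by adjoining elements one at a time. *)
Lemma not_thin_omega2 : ~ thin (sfull M) -> has_omega2_chain M.
Proof.
move=> nth.
have [N [leN nfgN]] : exists N : nat -> submodule M, (forall i, N i <=s N i.+1) /\
    forall n, exists2 i, (n <= i)%N & ~ fg (N i) (N i.+1).
  apply: contrapT => /forallNP nN; apply: nth => N leN _.
  apply: contrapT => /forallNP nn; apply: (nN N); split=> // n.
  apply: contrapT => /forall2NP ni; apply: (nn n) => i le_ni.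
  by apply: contrapT => nfg; case: (ni i).
have hE n : exists i, (n <= i)%N /\ ~ fg (N i) (N i.+1).
  by have [i] := nfgN n; exists i.
have [h hP] := choice hE.
pose j := fix j k := if k is k'.+1 then h (j k').+1 else h 0%N.
have jP k : ~ fg (N (j k)) (N (j k).+1) by case: k => [|k]; [case: (hP 0%N)|case: (hP (j k).+1)].
have lt_j k : (j k < j k.+1)%N by case: (hP (j k).+1).
have homo_j k k' : (k < k')%N -> (j k < j k')%N.
  by apply: (homo_ltn ltn_trans).
have [x xP] := choice (fun k => not_fg_seq (leN (j k)) (jP k)).
pose c (a : nat *l nat) := adjn (N (j a.1)) (x a.1) a.2.
have c_lo k i : N (j k) <=s c (k, i) by apply: (@adjn_homo _ _ _ _ 0).
have c_hi k i : c (k, i) <=s N (j k).+1.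
  by apply: adjn_min => [|l _]; [apply: leN|case: (xP k l)].
have c_lt k i k' i' : (k < k')%N -> c (k, i) <=s c (k', i').
  move=> /homo_j lt_kk'; apply: sle_trans (@c_hi _ _) _.
  by apply: sle_trans (@c_lo _ _); apply: (homo_sle leN).
have c_strict k i i' : (i < i')%N -> ~ c (k, i') <=s c (k, i).
  move=> lt_ii' le_c; have [_] := xP k i; apply; apply: le_c.
  exact: (@adjn_mem _ _ _ (x k)).
exists c => -[k i] [k' i']; rewrite Order.ProdLexiOrder.lexi_pair !leEnat.
split=> [/andP[le_kk' /implyP le_ii']|le_c].
  move: le_kk'; rewrite leq_eqVlt => /predU1P[eq_k|]; last exact: c_lt.
  by subst k'; apply: (@adjn_homo _ _ _ (x k)); apply: le_ii'.
case: (ltngtP k k') => //= [lt_k'k|eq_k].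
  have le_c' := sle_trans (@c_lt k' i'.+1 k i lt_k'k) le_c.
  by case: (@c_strict k' i' i'.+1 (ltnSn _) le_c').
subst k'; rewrite leqNgt; apply/negP => lt_i'i.
exact: (c_strict k _ _ lt_i'i).
Qed.

End Omega2.

(** Cantor's diagonal argument. *)
Lemma continuum_not_countable (A : comPzRingType) (M : lmodType A) :
  continuum_submodules M -> ~ countable [set: submodule M].
Proof.
move=> [f f_inj] /countable_injP[g g_inj].
have gf_inj S S' : g (f S) = g (f S') -> S = S'.
  by move=> /g_inj eq_f; apply: f_inj; apply: eq_f; rewrite inE.
pose D := [set n | exists S, g (f S) = n /\ ~ S n]%classic.
have [DD|nDD] := pselect (D (g (f D))).
  by have [S [/gf_inj -> nS]] := DD; apply: nS.
by apply: (nDD); exists D.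
Qed.

(** * The countable case and its failure *)

Section Main.
Variables (A : comPzRingType) (A_countable : countable [set: A]).
Variables (A_noetherian : ring_noetherian A) (M : lmodType A).

Lemma sub_countable_of_properties :
  [/\ module_minimax M, property_L2 M & property_L11 M] ->
  countable [set: submodule M].
Proof.
move=> [[Q [p [K [p_surj defK art noeK]]]] L2 L11].
have kerK : sub_ker p = K.
  apply: sub_ext => x; change (p x = 0 <-> submodule_set K x).
  by rewrite defK.
have fgK : fg (szero M) K := noetherian_sort_fg noeK.
have thQ : thin (sfull Q).
  by apply: contrapT => /not_thin_omega2; apply: L2 p_surj art.
have L11Q : property_L11 Q.
  move=> P artP nflP /(iso_to_subquotient_quotient p_surj).
  exact: L11.
have cQ := artinian_countable A_countable art.
have cM : countable [set: M].
  apply: (countable_fibers (f := p) cQ) => // y _.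
  have [x0 def_y] := p_surj y.
  apply: (countable_image2 (f := fun k x => k + x)
            (csub_fg A_countable fgK) (countable1 x0)).
  move=> x [_ px]; exists (x - x0); last by exists x0; rewrite // subrK.
  by rewrite /= -kerK; change (p (x - x0) = 0); rewrite linearB /= px def_y subrr.
apply: (minimax_sub_countable A_noetherian kerK fgK art cM).
exact: artinian_sub_countable.
Qed.

Lemma continuum_of_not_properties :
  ~ [/\ module_minimax M, property_L2 M & property_L11 M] ->
  continuum_submodules M.
Proof.
move=> nprop; apply: contrapT => nc; apply: nprop; split.
- by apply: contrapT => /(continuum_not_minimax A_noetherian).
- move=> Q p p_surj art omega2; apply: nc; apply: (continuum_quotient p_surj).
  by apply: continuum_not_thin => // /(thin_no_omega2 A_noetherian).
- move=> P art nfl sub; apply: nc; apply: (continuum_subquotient sub).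
  exact: continuum_square.
Qed.

End Main.

Local Open Scope classical_set_scope.
Local Open Scope card_scope.

Theorem theorem1p9 (A : comPzRingType) (M : lmodType A)
    (A_countable : countable [set: A]) (A_noetherian : ring_noetherian A) :
  (countable [set: submodule M] <->
     [/\ module_minimax M, property_L2 M & property_L11 M]) /\
  (~ countable [set: submodule M] ->
     [set: set nat] #<= [set: submodule M] /\
     (countable [set: M] -> [set: submodule M] #= [set: set nat])).
Proof.
have card_inj (T U : Type) (f : T -> U) : injective f -> [set: T] #<= [set: U].
  move=> f_inj; rewrite -(preimage_setT f).
  by apply: card_ge_preimage => x y _ _; apply: f_inj.
split.
  split; last exact: sub_countable_of_properties.
  move=> cS; apply: contrapT => /(continuum_of_not_properties A_noetherian).
  by move=> /continuum_not_countable.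
move=> ncS; have [f f_inj] : continuum_submodules M.
  apply: (continuum_of_not_properties A_noetherian) => /sub_countable_of_properties.
  by move=> /(_ A_countable A_noetherian).
have le_f : [set: set nat] #<= [set: submodule M] by apply: card_inj f_inj.
split=> // /countable_injP[g g_inj].
rewrite card_eq_le le_f andbT.
(* A submodule is encoded by the set of codes of its elements. *)
apply: (card_inj _ _ (fun H : submodule M => g @` [set x | H x])) => H H' eqH.
apply: sub_ext => x.
have mem (N : submodule M) : N x <-> (g @` [set y | N y]) (g x).
  split=> [Nx|[y Ny /g_inj eq_yx]]; first by exists x.
  by rewrite -eq_yx ?inE.
by rewrite !mem eqH.
Qed.
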